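(* Let $N$ be a topological space with a (nonzero) Borel measure $\nu$, $f:N\to\mathbb{R}$ a bounded continuous function, $\Gamma$ a smooth manifold with a flat torsion-free affine connection $D$, and $\theta:\Gamma\to\mathbb{R}$ a smooth function with nowhere vanishing differential, such that for every $\xi\in\Gamma$ the measure $e^{\theta(\xi)f}\nu$ has finite total mass. Let $z(\xi)=\ln\int_Ne^{\theta(\xi)f}\,\nu$. Then for every integer $n\ge1$, $$D^nz=\sum_{j=1}^n\frac1{j!}\,\mathbb{E}_\xi[f_j]\,\frac{\mathfrak{S}}{n!}\left(\sum_{\substack{k:\{1,\dots,j\}\to\mathbb{N}\\ \sum_ik_i=n-j}}\binom{n}{k_1+1,\dots,k_j+1}\,D^{k_1}d\theta\otimes\cdots\otimes D^{k_j}d\theta\right),$$ where the functions $f_j$, the expectation $\mathbb{E}_\xi$ and the operator $\mathfrak{S}$ are defined in the context.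
   Context: $\mathbb{N}$ includes $0$. $\nu_\xi=e^{\theta(\xi)f-z(\xi)}\nu$ is a probability measure on $N$ and $\mathbb{E}_\xi[h]=\int_Nh\,\nu_\xi$ (for a function $h$ on $N\times\Gamma$, $\mathbb{E}_\xi[h]=\int_Nh(\cdot,\xi)\,\nu_\xi$). Put $\hat f(x,\xi)=f(x)-\mathbb{E}_\xi[f]$. The functions $f_n$ on $N\times\Gamma$ are defined by $f_1=f$, $f_2=\hat f^2$, and $f_{n+1}=\hat f f_n+\frac{\partial f_n}{\partial\theta(\xi)}$ for $n\ge2$; here all functions depend only on $x\in N$ and $\theta(\xi)$, and $\frac{\partial}{\partial\theta(\xi)}$ is the derivative with respect to the real variable $\theta(\xi)$ with $x$ fixed. $\mathfrak{S}$ is the unnormalised symmetrisation of covariant $n$-tensors, $\mathfrak{S}(a)=\sum_{\sigma\in\mathcal{S}_n}\sigma\cdot a$. $\binom{n}{l_1,\dots,l_j}=\frac{n!}{l_1!\cdots l_j!}$. $D^n$ denotes the $n$-th iterated covariant differential, so $D^nz$ is a covariant $n$-tensor and $D^{k}d\theta$ a covariant $(k+1)$-tensor. *)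

(* Defs.v *)
From HB Require Import structures.
From mathcomp Require Import all_boot all_order all_algebra all_fingroup.
From mathcomp Require Import ring.
From mathcomp Require Import all_classical all_reals all_analysis.

Set Implicit Arguments.
Unset Strict Implicit.
Unset Printing Implicit Defensive.

Import Order.TTheory GRing.Theory Num.Theory.
Import numFieldNormedType.Exports.

Local Open Scope classical_set_scope.
Local Open Scope ring_scope.

(* Smooth functions on open subsets of R^d. *)

Section smooth_on.
Context {R : realType} {d : nat}.
Implicit Types (U : set 'rV[R]_d) (g h : 'rV[R]_d -> R).

Fixpoint Ck_on (k : nat) U g : Prop :=
  (forall x, U x -> {for x, continuous g}) /\
  (if k is m.+1 then
     forall i : 'I_d, (forall x, U x -> derivable g x (delta_mx 0 i)) /\
                      Ck_on m U ('D_(delta_mx 0 i) g)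
   else True).

(* [U] is meant to be open: then this is the usual "all partial derivatives of
   all orders exist and are continuous on [U]". *)
Definition smooth_on U g := forall k, Ck_on k U g.

Lemma Ck_on_cont k U g : Ck_on k U g -> forall x, U x -> {for x, continuous g}.
Proof. by case: k => [|k] []. Qed.

Lemma Ck_onW k U g : Ck_on k.+1 U g -> Ck_on k U g.
Proof.
elim: k g => [|k IH] g [cg dg]; first by split.
by split=> // i; have [? ?] := dg i; split=> //; exact: IH.
Qed.

Lemma Ck_on_eq k U g h : open U -> {in U, g =1 h} -> Ck_on k U g -> Ck_on k U h.
Proof.
move=> oU; have neq (a b : 'rV[R]_d -> R) x : {in U, a =1 b} -> U x ->
    {near x, a =1 b}.
  move=> ab Ux; have : \forall y \near x, U y by exact: open_nbhs_nbhs.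
  by apply: filterS => y Uy; apply: ab; rewrite inE.
have ceq (a b : 'rV[R]_d -> R) x : {in U, a =1 b} -> U x ->
    {for x, continuous a} -> {for x, continuous b}.
  move=> ab Ux; rewrite /prop_for /continuous_at -ab ?inE//.
  have ab' := neq a b x ab Ux.
  exact: cvg_trans (@near_eq_cvg _ _ (nbhs x) _ a b ab').
elim: k g h => [|k IH] g h gh [cg dg].
  by split=> // x Ux; exact: ceq gh Ux (cg x Ux).
split=> [x Ux|i]; first exact: ceq gh Ux (cg x Ux).
have [dgi ci] := dg i; split=> [x Ux|].
  exact: near_eq_derivable (neq _ _ x gh Ux) (dgi x Ux).
apply: IH ci => x; rewrite inE => Ux.
exact: near_eq_derive (neq _ _ x gh Ux).
Qed.

Lemma Ck_on_cst k U c : Ck_on k U (cst c).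
Proof.
elim: k c => [|k IH] c; split=> //; try by move=> x _; exact: cst_continuous.
move=> i; split=> [x _|]; first exact: derivable_cst.
suff -> : 'D_(delta_mx 0 i) (cst c : 'rV[R]_d -> R) = cst 0 by exact: IH.
by apply/funext => x; rewrite derive_cst.
Qed.

Lemma Ck_onD k U g h : open U -> Ck_on k U g -> Ck_on k U h -> Ck_on k U (g + h).
Proof.
move=> oU; elim: k g h => [|k IH] g h [cg dg] [ch dh].
  by split=> // x Ux; apply: continuousD; [exact: cg|exact: ch].
split=> [x Ux|i]; first by apply: continuousD; [exact: cg|exact: ch].
have [dgi cgi] := dg i; have [dhi chi] := dh i; split=> [x Ux|].
  by apply: derivableD; [exact: dgi|exact: dhi].
apply: Ck_on_eq oU _ (IH _ _ cgi chi) => x; rewrite inE => Ux.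
by rewrite deriveD; [|exact: dgi|exact: dhi].
Qed.

Lemma Ck_onM k U g h : open U -> Ck_on k U g -> Ck_on k U h -> Ck_on k U (g * h).
Proof.
move=> oU; elim: k g h => [|k IH] g h Cg Ch.
  by split=> // x Ux; apply: continuousM; [exact: Cg.1|exact: Ch.1].
split=> [x Ux|i]; first by apply: continuousM; [exact: Cg.1|exact: Ch.1].
have [dgi cgi] := Cg.2 i; have [dhi chi] := Ch.2 i; split=> [x Ux|].
  by apply: derivableM; [exact: dgi|exact: dhi].
have := Ck_onD oU (IH _ _ (Ck_onW Cg) chi) (IH _ _ (Ck_onW Ch) cgi).
apply: Ck_on_eq oU _ => x; rewrite inE => Ux.
by rewrite deriveM; [|exact: dgi|exact: dhi].
Qed.

End smooth_on.

(* A chart is represented by total functions, meaningful only on its domain,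
   resp. on the image of its domain. *)
Record chart (R : realType) (d : nat) (M : topologicalType) := Chart {
  chart_dom : set M ;
  chart_map : M -> 'rV[R]_d ;
  chart_inv : 'rV[R]_d -> M }.

Section charts.
Context {R : realType} {d : nat} {M : topologicalType}.
Implicit Types c : chart R d M.

Definition chart_image c : set 'rV[R]_d := chart_map c @` chart_dom c.

Definition chart_homeo c :=
  [/\ open (chart_dom c), open (chart_image c),
      forall x, chart_dom c x -> chart_inv c (chart_map c x) = x,
      forall x, chart_dom c x -> {for x, continuous (chart_map c)} &
      forall y, chart_image c y -> {for y, continuous (chart_inv c)}].

Definition smooth_transition c c' := forall i : 'I_d,
  smooth_on (chart_map c @` (chart_dom c `&` chart_dom c'))
            (fun y => chart_map c' (chart_inv c y) 0 i).

End charts.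

Record smoothManifold (R : realType) (d : nat) := SmoothManifold {
  manifold_carrier :> topologicalType ;
  atlas : set (chart R d manifold_carrier) ;
  _ : hausdorff_space manifold_carrier ;
  _ : @second_countable manifold_carrier ;
  atlas_homeo : forall c, atlas c -> chart_homeo c ;
  atlas_cover : forall x, exists2 c, atlas c & chart_dom c x ;
  atlas_transition : forall c c', atlas c -> atlas c' -> smooth_transition c c' }.

(* The algebra of smooth functions. *)

Section smooth_functions.
Context {R : realType} {d : nat} (M : smoothManifold R d).

Definition smooth : {pred M -> R} := mem [set g : M -> R |
  forall c, atlas c -> smooth_on (chart_image c) (g \o chart_inv c)].

Lemma smooth_subring_closed : subring_closed smooth.
Proof.
have sM g h : g \in smooth -> h \in smooth -> g * h \in smooth.
  rewrite !inE => sg sh c Ac k; have [_ oU _ _ _] := atlas_homeo Ac.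
  exact: Ck_onM (sg c Ac k) (sh c Ac k).
have sC a : cst a \in smooth by rewrite inE => c Ac k; exact: Ck_on_cst.
split=> // [|g h sg sh]; first exact: sC.
have -> : g - h = g + (cst (-1) * h) by apply/funext => x /=; rewrite !fctE mulN1r.
have {sh} := sM _ _ (sC (-1)) sh; move: sg; rewrite !inE => sg sh c Ac k.
have [_ oU _ _ _] := atlas_homeo Ac.
exact: Ck_onD (sg c Ac k) (sh c Ac k).
Qed.

HB.instance Definition _ := GRing.isSubringClosed.Build _ smooth
  smooth_subring_closed.

Lemma smooth_scaler_closed : GRing.scaler_closed smooth.
Proof.
move=> a g; rewrite !inE => sg c Ac k; have [_ oU _ _ _] := atlas_homeo Ac.
exact: (Ck_onM oU (@Ck_on_cst _ _ k _ a) (sg c Ac k)).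
Qed.

HB.instance Definition _ := GRing.isScaleClosed.Build _ _ smooth
  smooth_scaler_closed.

Record smoothFun := SmoothFun { smoothFun_val :> M -> R ; _ : smoothFun_val \in smooth }.

HB.instance Definition _ := [isSub for smoothFun_val].
HB.instance Definition _ := [Choice of smoothFun by <:].
HB.instance Definition _ :=
  GRing.SubChoice_isSubComPzRing.Build (M -> R) smooth smoothFun smooth_subring_closed.
HB.instance Definition _ := [SubZmodule_isSubLmodule of smoothFun by <:].

Lemma smoothFunD (g h : smoothFun) x : (g + h) x = g x + h x. Proof. by []. Qed.
Lemma smoothFunN (g : smoothFun) x : (- g) x = - g x. Proof. by []. Qed.
Lemma smoothFunM (g h : smoothFun) x : (g * h) x = g x * h x. Proof. by []. Qed.
Lemma smoothFunZ a (g : smoothFun) x : (a *: g) x = a * g x. Proof. by []. Qed.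
Definition smoothFunE := (smoothFunD, smoothFunN, smoothFunM, smoothFunZ).

Lemma smoothFun_eqP (g h : smoothFun) : g =1 h -> g = h.
Proof. by move=> gh; apply/val_inj/funext. Qed.

End smooth_functions.

(* Vector fields are the derivations of the algebra of smooth functions; they
   form a module over that algebra. *)

Section vector_fields.
Context {R : realType} {d : nat} (M : smoothManifold R d).

Definition derivation : {pred smoothFun M -> (smoothFun M)^o} :=
  mem [set X : smoothFun M -> (smoothFun M)^o |
    (forall (a : R) (g h : smoothFun M),
       X (a *: g + h) = a *: (X g : smoothFun M) + X h :> smoothFun M) /\
    (forall g h : smoothFun M, X (g * h) = X g * h + g * X h :> smoothFun M)].

Lemma derivation_submod_closed : submod_closed derivation.
Proof.
split; rewrite /= ?inE /=.
  split=> [a g h|g h]; apply: smoothFun_eqP => x.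
    by rewrite -[LHS]/(0 : R) -[RHS]/(a * 0 + 0); ring.
  by rewrite -[LHS]/(0 : R) -[RHS]/(0 * h x + g x * 0); ring.
move=> u X Y; rewrite !inE => -[X1 X2] [Y1 Y2]; split=> [a g h|g h].
  by rewrite !fctE X1 Y1; apply: smoothFun_eqP => x; rewrite !smoothFunE; ring.
by rewrite !fctE X2 Y2; apply: smoothFun_eqP => x; rewrite !smoothFunE; ring.
Qed.

HB.instance Definition _ := GRing.isSubmodClosed.Build _ _ derivation
  derivation_submod_closed.

Record vfield := VField {
  vfield_val :> smoothFun M -> (smoothFun M)^o ; _ : vfield_val \in derivation }.

HB.instance Definition _ := [isSub for vfield_val].
HB.instance Definition _ := [Choice of vfield by <:].
HB.instance Definition _ := [SubChoice_isSubLmodule of vfield by <:].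

Lemma bracket_subproof (X Y : vfield) :
  (fun g : smoothFun M => X (Y g) - Y (X g)) \in derivation.
Proof.
case: X Y => [X pX] [Y pY] /=; move: pX pY; rewrite !inE => -[X1 X2] [Y1 Y2].
have XD g h : X (g + h) = X g + X h by have := X1 1 g h; rewrite !scale1r.
have YD g h : Y (g + h) = Y g + Y h by have := Y1 1 g h; rewrite !scale1r.
split=> [a g h|g h].
  by rewrite X1 Y1 X1 Y1; apply: smoothFun_eqP => x; rewrite !smoothFunE; ring.
by rewrite X2 Y2 XD YD !X2 !Y2; apply: smoothFun_eqP => x; rewrite !smoothFunE; ring.
Qed.

Definition bracket (X Y : vfield) : vfield := VField (bracket_subproof X Y).

End vector_fields.

Record connection (R : realType) (d : nat) (M : smoothManifold R d) := Connection {
  nabla :> vfield M -> vfield M -> vfield M ;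
  nablaPl : forall (u : smoothFun M) (X Y Z : vfield M),
    nabla (u *: X + Y) Z = u *: nabla X Z + nabla Y Z ;
  nablaDr : forall X Y Z : vfield M, nabla X (Y + Z) = nabla X Y + nabla X Z ;
  nabla_Leibniz : forall (u : smoothFun M) (X Y : vfield M),
    nabla X (u *: Y) = (X u : smoothFun M) *: Y + u *: nabla X Y }.

Section covariant_tensors.
Context {R : realType} {d : nat} {M : smoothManifold R d}.
Implicit Types (D : connection M).

Definition torsion_free D := forall X Y : vfield M, D X Y - D Y X = bracket X Y.

Definition flat D := forall X Y Z : vfield M,
  D X (D Y Z) - D Y (D X Z) - D (bracket X Y) Z = 0.

(* A covariant [n]-tensor field is given by its values on [n] vector fields.
   Multilinearity over the smooth functions is not part of the type; the
   operations below preserve it. *)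
Definition covariant (n : nat) := ('I_n -> vfield M) -> smoothFun M.

Definition differential (g : smoothFun M) : covariant 1 := fun X => X ord0 g.

(* The differentiating vector field goes in the first slot. *)
Definition covdiff D n (T : covariant n) : covariant n.+1 := fun X =>
  X ord0 (T (fun l => X (lift ord0 l))) -
  \sum_(i < n) T (fun l => if l == i then D (X ord0) (X (lift ord0 i))
                           else X (lift ord0 l)).

Fixpoint covdiff_form D (w : covariant 1) (k : nat) : covariant k.+1 :=
  if k is m.+1 then covdiff D (@covdiff_form D w m) else w.

Definition covdiff_fun D (g : smoothFun M) (n : nat) : covariant n :=
  match n with
  | 0 => fun=> g
  | m.+1 => @covdiff_form D (differential g) m
  end.

(* The [i]-th factor receives the [i]-th block of consecutive arguments. *)
Definition tensor_prod j (m : 'I_j -> nat) (T : forall i, covariant (m i)) :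
    covariant (\sum_(i < j) m i) :=
  fun X => \prod_(i < j) T i (fun l => X (tagnat.Rank i l)).

Definition cast_covariant m n (e : m = n) (T : covariant m) : covariant n :=
  fun X => T (fun l => X (cast_ord e l)).

Definition symmetrise n (T : covariant n) : covariant n :=
  fun X => \sum_(s : 'S_n) T (fun l => X (s l)).

End covariant_tensors.

Arguments covdiff_form {R d M} D w k X.
Arguments covdiff_fun {R d M} D g n X.

(* The functions [k] from [1..j] to the natural numbers with [\sum_i k i = n - j]
   (there are none when [n < j]); such a [k] is bounded by [n]. *)
Definition offsets (n j : nat) :=
  {k : {ffun 'I_j -> 'I_n.+1} | (\sum_(i < j) k i + j == n)%N}.

Lemma offsets_order n j (k : offsets n j) : (\sum_(i < j) (val k i).+1 = n)%N.
Proof.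
case: k => k /= /eqP kn; under eq_bigr do rewrite -addn1.
by rewrite big_split /= sum1_card card_ord.
Qed.

Definition multinomial (n j : nat) (l : 'I_j -> nat) : nat :=
  (n`! %/ \prod_(i < j) (l i)`!)%N.

Notation borel N := (g_sigma_algebraType (@open N)).

Section exponential_family.
Context {R : realType} {N : ptopologicalType}.
Context (nu : {measure set (borel N) -> \bar R}) (f : N -> R).

Definition log_partition (t : R) : R := ln (\int[nu]_x expR (t * f x)).

(* Expectation under [e^(t f - z) nu] with [t] the value of theta at xi. *)
Definition gibbs_mean (t : R) (h : N -> R) : R :=
  \int[nu]_x (h x * expR (t * f x - log_partition t)).

Definition fhat (x : N) (t : R) : R := f x - gibbs_mean t f.

(* [fseq n x t] is [f_n] at [x] and theta = [t], for [n >= 1]; the value at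
   [n = 0] is irrelevant. *)
Fixpoint fseq (n : nat) (x : N) (t : R) : R :=
  match n with
  | 0 | 1 => f x
  | 2 => fhat x t ^+ 2
  | m.+1 => fhat x t * fseq m x t + derive1 (fseq m x) t
  end.

End exponential_family.

(* Main.v *)
(* Arguments of tensors are collected in lists of vector fields, and [W] is the
   list function with value D^(k-1) d theta on lists of length k >= 1 and 0 on the
   empty list. Putting a vector field Y in front of the list and applying the
   covariant derivative along Y are both derivations of the shuffle product, and
   W(Y :: s) = D_Y W(s) + [s = nil] Y(theta). Hence, for the shuffle powers W^j,
   the sum of Z^(j)(theta) / j! W^j(s) satisfies the recursion that defines D^n z,
   Z being the log-partition function, whose derivatives are E[f_j].
   To recognise the symmetrised tensor products, note that summing a list
   function over all rearrangements turns the concatenation product into the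
   shuffle product, because inserting a letter is a derivation of the former.
   Applied to W(s) / (size s)!, whose sum over rearrangements is W because flatness
   and torsion-freeness make D^k d theta symmetric, this identifies W^j with
   the sum over offsets: multinomial / n! is the product of the 1 / (k_i + 1)!. *)
Require Import Defs.
From HB Require Import structures.
From mathcomp Require Import all_boot all_order all_algebra all_fingroup.
From mathcomp Require Import ring lra zify.
From mathcomp Require Import all_classical all_reals all_analysis.
From mathcomp Require Import measurable_realfun.

Set Implicit Arguments.
Unset Strict Implicit.
Unset Printing Implicit Defensive.

Import Order.TTheory GRing.Theory Num.Theory.
Import numFieldNormedType.Exports.

Local Open Scope classical_set_scope.
Local Open Scope ring_scope.

(** * Functions on lists: shuffle and concatenation products *)

Section shuffle_product.
Context {A : Type} {K : comPzRingType}.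
Implicit Types (F G H : seq A -> K) (E : A -> A) (s t u v : seq A).

(** Unfolded, this is the sum of [F u * G v] over all splittings of [s] into complementary
    subsequences [u] and [v], each head going to one side or the other. *)
Fixpoint shuffle F G s : K :=
  if s is x :: t then
    shuffle (fun u => F (x :: u)) G t + shuffle F (fun u => G (x :: u)) t
  else F [::] * G [::].

Definition empty_one s : K := (nilp s)%:R.

Definition shuffle_pow F j := iter j (shuffle F) empty_one.

Lemma eq_shuffle F F' G G' s :
  (forall u, (size u <= size s)%N -> F u = F' u) ->
  (forall u, (size u <= size s)%N -> G u = G' u) ->
  shuffle F G s = shuffle F' G' s.
Proof.
elim: s F F' G G' => [|x s IH] F F' G G' FF GG /=; first by rewrite FF ?GG.
by congr (_ + _); apply: IH => u us; rewrite ?FF ?GG// ltnW.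
Qed.

Lemma shuffleDl F F' G s :
  shuffle (fun u => F u + F' u) G s = shuffle F G s + shuffle F' G s.
Proof.
elim: s F F' G => [|x s IH] F F' G /=; first by rewrite mulrDl.
by rewrite !IH addrACA.
Qed.

Lemma shuffleDr F G G' s :
  shuffle F (fun u => G u + G' u) s = shuffle F G s + shuffle F G' s.
Proof.
elim: s F G G' => [|x s IH] F G G' /=; first by rewrite mulrDr.
by rewrite !IH addrACA.
Qed.

Lemma shuffleZl a F G s :
  shuffle (fun u => a * F u) G s = a * shuffle F G s.
Proof.
elim: s F G => [|x s IH] F G /=; first by rewrite mulrA.
by rewrite !IH mulrDr.
Qed.

Lemma shuffleZr a F G s :
  shuffle F (fun u => a * G u) s = a * shuffle F G s.
Proof.
elim: s F G => [|x s IH] F G /=; first by rewrite mulrCA.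
by rewrite !IH mulrDr.
Qed.

Lemma shuffle0l G s : shuffle (fun=> 0) G s = 0.
Proof. by elim: s G => [|x s IH] G /=; rewrite ?mul0r// !IH addr0. Qed.

Lemma shuffle1l F s : shuffle empty_one F s = F s.
Proof.
elim: s F => [|x s IH] F /=; first by rewrite mul1r.
by rewrite shuffle0l add0r IH.
Qed.

(** However a list shorter than [m + n] is split, one of the two parts is too short. *)
Lemma shuffle_eq0 m n F G s :
  (forall u, (size u < m)%N -> F u = 0) ->
  (forall u, (size u < n)%N -> G u = 0) ->
  (size s < m + n)%N -> shuffle F G s = 0.
Proof.
elim: s m n F G => [|x s IH] m n F G F0 G0 /= smn.
  case: m F0 smn => [|m] F0 smn; last by rewrite F0 ?mul0r.
  by rewrite G0 ?mulr0.
rewrite (IH m.-1 n) ?(IH m n.-1) ?addr0//; try lia.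
  by move=> u un; apply: G0 => /=; lia.
by move=> u un; apply: F0 => /=; lia.
Qed.

Lemma shuffle_pow_eq0 F j s : F [::] = 0 -> (size s < j)%N ->
  shuffle_pow F j s = 0.
Proof.
move=> F0; elim: j s => [//|j IH] s sj /=.
by apply: (@shuffle_eq0 1 j) => // -[].
Qed.

(** With [E] the covariant derivative along Y, this is the correction term in the covariant
    derivative of a tensor. *)
Fixpoint subst_deriv E F s : K :=
  if s is x :: t then F (E x :: t) + subst_deriv E (fun u => F (x :: u)) t else 0.

Lemma subst_deriv_cons E F x s :
  subst_deriv E F (x :: s) = F (E x :: s) + subst_deriv E (fun u => F (x :: u)) s.
Proof. by []. Qed.

Lemma eq_subst_deriv E F G s : (forall u, size u = size s -> F u = G u) ->
  subst_deriv E F s = subst_deriv E G s.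
Proof.
elim: s F G => [|x s IH] F G FG //=.
by rewrite FG//; congr (_ + _); apply: IH => u us; rewrite FG//= us.
Qed.

Lemma subst_derivD E F G s :
  subst_deriv E (fun u => F u + G u) s = subst_deriv E F s + subst_deriv E G s.
Proof.
elim: s F G => [|x s IH] F G /=; first by rewrite addr0.
by rewrite IH addrACA.
Qed.

Lemma subst_derivZ E a F s :
  subst_deriv E (fun u => a * F u) s = a * subst_deriv E F s.
Proof.
by elim: s F => [|x s IH] F /=; rewrite ?mulr0// IH mulrDr.
Qed.

Lemma subst_deriv0 E s : subst_deriv E (fun=> 0) s = 0.
Proof. by elim: s => //= x s ->; rewrite addr0. Qed.

Lemma subst_deriv_sum E (I : Type) (r : seq I) (P : pred I) (F : I -> seq A -> K) s :
  subst_deriv E (fun u => \sum_(i <- r | P i) F i u) s =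
  \sum_(i <- r | P i) subst_deriv E (F i) s.
Proof.
elim: s F => [|x s IH] F /=; first by rewrite big1.
by rewrite IH big_split.
Qed.

Lemma subst_deriv_morph E (phi : K -> K) F s : phi 0 = 0 -> {morph phi : a b / a + b} ->
  subst_deriv E (fun u => phi (F u)) s = phi (subst_deriv E F s).
Proof.
by move=> phi0 phiD; elim: s F => [|x s IH] F /=; rewrite ?phi0// IH phiD.
Qed.

(** The altered entry lies in exactly one of the two parts of a splitting. *)
Lemma subst_deriv_shuffle E F G s :
  subst_deriv E (shuffle F G) s =
  shuffle (subst_deriv E F) G s + shuffle F (subst_deriv E G) s.
Proof.
elim: s F G => [|x s IH] F G /=; first by rewrite mul0r mulr0 addr0.
by rewrite subst_derivD !IH shuffleDl shuffleDr; ring.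
Qed.

Lemma shuffle_deriv (phi : K -> K) F G s : {morph phi : a b / a + b} ->
  (forall a b, phi (a * b) = phi a * b + a * phi b) ->
  phi (shuffle F G s) =
  shuffle (fun u => phi (F u)) G s + shuffle F (fun u => phi (G u)) s.
Proof.
move=> phiD phiM; elim: s F G => [|x s IH] F G /=; first exact: phiM.
by rewrite phiD !IH addrACA.
Qed.

End shuffle_product.

Section shuffle_morphism.
Context {A : Type} {K L : comPzRingType} (phi : {rmorphism K -> L}).
Implicit Types (F G : seq A -> K) (s : seq A).

Lemma rmorph_shuffle F G s :
  phi (shuffle F G s) = shuffle (fun u => phi (F u)) (fun u => phi (G u)) s.
Proof.
elim: s F G => [|x s IH] F G /=; first by rewrite rmorphM.
by rewrite rmorphD !IH.
Qed.

Lemma rmorph_shuffle_pow F j s :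
  phi (shuffle_pow F j s) = shuffle_pow (fun u => phi (F u)) j s.
Proof.
elim: j s => [|j IH] s /=; first by rewrite rmorph_nat.
by rewrite rmorph_shuffle; apply: eq_shuffle => u _; rewrite ?IH.
Qed.

End shuffle_morphism.

(** * Symmetry and additivity of list functions *)

Section symmetry.
Context {A : Type} {K : comPzRingType}.
Implicit Types (F G H : seq A -> K) (E : A -> A) (s t u v : seq A).

(** Adjacent transpositions generate all permutations, and for iterated differentials they reduce to
    an exchange of the two leading slots. *)
Definition swap_invariant F :=
  forall u x y v, F (u ++ x :: y :: v) = F (u ++ y :: x :: v).

Lemma swap_invariant_subst_deriv E F :
  swap_invariant F -> swap_invariant (subst_deriv E F).
Proof.
move=> FS u; elim: u F FS => [|z u IH] F FS x y v /=.
  rewrite !addrA; congr (_ + _); last first.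
    by apply: eq_subst_deriv => u _; exact: (FS [::]).
  by rewrite addrC; congr (_ + _); exact: (FS [::]).
congr (_ + _); first exact: (FS (_ :: u)).
by apply: IH => u' x' y' v'; exact: (FS (z :: u')).
Qed.

End symmetry.

Section additivity.
Context {A : zmodType} {K : comPzRingType}.
Implicit Types (F G H : seq A -> K) (E : A -> A) (s t u v : seq A).

Definition multiadditive F :=
  forall u x y v, F (u ++ (x + y) :: v) = F (u ++ x :: v) + F (u ++ y :: v).

Lemma multiadditive_cons F x : multiadditive F -> multiadditive (fun s => F (x :: s)).
Proof. by move=> FA u; exact: (FA (x :: u)). Qed.

Lemma subst_derivDl E E' F s : multiadditive F ->
  subst_deriv (fun x => E x + E' x) F s = subst_deriv E F s + subst_deriv E' F s.
Proof.
elim: s F => [|x s IH] F FA /=; first by rewrite addr0.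
by rewrite (FA [::]) IH; [rewrite addrACA|exact: multiadditive_cons].
Qed.

Lemma multiadditive_subst_deriv E F : {morph E : a b / a + b} ->
  multiadditive F -> multiadditive (subst_deriv E F).
Proof.
move=> ED FA u; elim: u F FA => [|z u IH] F FA x y v /=.
  rewrite ED (FA [::]) (@eq_subst_deriv _ _ _ _ (fun u => F (x :: u) + F (y :: u))).
    by rewrite subst_derivD addrACA.
  by move=> u _; exact: (FA [::]).
by rewrite (FA (_ :: u)) IH; [rewrite addrACA|exact: multiadditive_cons].
Qed.

(** Terms in which [E1] and [E2] hit different entries agree in both orders. On a common entry the
    operators compose, and the hypothesis compares the two composites; for covariant derivatives it
    will come from flatness and absence of torsion. *)
Lemma subst_deriv_comm E1 E2 E3 E4 F s : multiadditive F ->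
  (forall x, E2 (E1 x) + E3 x = E1 (E2 x) + E4 x) ->
  subst_deriv E1 (subst_deriv E2 F) s + subst_deriv E3 F s =
  subst_deriv E2 (subst_deriv E1 F) s + subst_deriv E4 F s.
Proof.
move=> FA EE; elim: s F FA => [|x s IH] F FA //=.
have e := FA [::] (E2 (E1 x)) (E3 x) s.
rewrite /= EE (FA [::]) /= in e.
have e' := IH _ (multiadditive_cons x FA).
rewrite !subst_derivD; transitivity (F (E2 (E1 x) :: s) + F (E3 x :: s) +
  (subst_deriv E1 (subst_deriv E2 (fun u => F (x :: u))) s +
   subst_deriv E3 (fun u => F (x :: u)) s) +
  (subst_deriv E2 (fun u => F (E1 x :: u)) s +
   subst_deriv E1 (fun u => F (E2 x :: u)) s)); first by ring.
by rewrite -e e'; ring.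
Qed.

End additivity.

(** * Concatenation product and sums over rearrangements *)

Section concatenation_product.
Context {A : Type} {K : comPzRingType}.
Implicit Types (F G H : seq A -> K) (s t u v : seq A).

Fixpoint conc F G s : K :=
  F [::] * G s + (if s is x :: t then conc (fun u => F (x :: u)) G t else 0).

Fixpoint insert_sum x F s : K :=
  F (x :: s) + (if s is y :: t then insert_sum x (fun u => F (y :: u)) t else 0).

(* The (size s)! rearrangements of [s] are listed by inserting its head at every
   place of the rearrangements of its tail. *)
Fixpoint arrangements_sum F s : K :=
  if s is x :: t then arrangements_sum (insert_sum x F) t else F [::].

Definition conc_pow F j := iter j (conc F) empty_one.

Lemma eq_insert_sum x F G : F =1 G -> insert_sum x F =1 insert_sum x G.
Proof.
move=> FG s; elim: s F G FG => [|y s IH] F G FG /=; rewrite FG//.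
by congr (_ + _); apply: IH => u.
Qed.

Lemma eq_arrangements_sum F G : F =1 G -> arrangements_sum F =1 arrangements_sum G.
Proof.
move=> FG s; elim: s F G FG => [|y s IH] F G FG /=; first exact: FG.
by apply: IH; exact: eq_insert_sum.
Qed.

Lemma concDl F F' G s : conc (fun u => F u + F' u) G s = conc F G s + conc F' G s.
Proof.
elim: s F F' => [|x s IH] F F' /=; first by rewrite !addr0 mulrDl.
by rewrite IH mulrDl; ring.
Qed.

Lemma insert_sumD x F G s :
  insert_sum x (fun u => F u + G u) s = insert_sum x F s + insert_sum x G s.
Proof.
elim: s F G => [|y s IH] F G /=; first by rewrite !addr0.
by rewrite IH addrACA.
Qed.

Lemma insert_sumZ x a F s :
  insert_sum x (fun u => a * F u) s = a * insert_sum x F s.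
Proof.
elim: s F => [|y s IH] F /=; first by rewrite !addr0.
by rewrite IH mulrDr.
Qed.

Lemma arrangements_sumD F G s : arrangements_sum (fun u => F u + G u) s =
  arrangements_sum F s + arrangements_sum G s.
Proof.
elim: s F G => [//|y s IH] F G /=.
by rewrite -IH; apply: eq_arrangements_sum => u; exact: insert_sumD.
Qed.

Lemma insert_sum0 x s : insert_sum x (fun=> 0) s = 0 :> K.
Proof. by elim: s => [|y s IH] /=; rewrite ?addr0// IH addr0. Qed.

Lemma arrangements_sum0 s : arrangements_sum (fun=> 0) s = 0 :> K.
Proof.
elim: s => //= x s IH; rewrite -[RHS]IH.
by apply: eq_arrangements_sum => u; exact: insert_sum0.
Qed.

(** When the enlarged list is cut, [x] falls into the prefix or into the suffix. An [x] inserted at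
    a cut of [s] occurs once on each side, since the new list can be cut before or after it. *)
Lemma insert_sum_conc x F G s :
  insert_sum x (conc F G) s =
  conc (insert_sum x F) G s + conc F (insert_sum x G) s.
Proof.
elim: s F => [|y s IH] F /=; first by rewrite !addr0; ring.
rewrite insert_sumD insert_sumZ IH concDl /=; ring.
Qed.

(** By [insert_sum_conc] the head of [s], once inserted, belongs to one of the two factors: this is
    the recursion of [shuffle]. *)
Lemma arrangements_sum_conc F G s :
  arrangements_sum (conc F G) s =
  shuffle (arrangements_sum F) (arrangements_sum G) s.
Proof.
elim: s F G => [|x s IH] F G /=; first by rewrite addr0.
by rewrite -!IH -arrangements_sumD; apply: eq_arrangements_sum => u; exact: insert_sum_conc.
Qed.

Lemma arrangements_sum_empty_one s : arrangements_sum empty_one s = empty_one s.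
Proof.
case: s => //= x s; rewrite (@eq_arrangements_sum _ (fun=> 0)) ?arrangements_sum0// => u.
by case: u => [|y u] /=; rewrite ?insert_sum0 addr0.
Qed.

Lemma arrangements_sum_conc_pow F j s :
  arrangements_sum (conc_pow F j) s = shuffle_pow (arrangements_sum F) j s.
Proof.
elim: j s => [|j IH] s /=; first exact: arrangements_sum_empty_one.
by rewrite arrangements_sum_conc; apply: eq_shuffle => u _.
Qed.

Lemma insert_sum_swap x F s : swap_invariant F ->
  insert_sum x F s = F (x :: s) *+ (size s).+1.
Proof.
elim: s F => [|y s IH] F FS /=; first by rewrite addr0.
rewrite IH; last by move=> u; exact: (FS (y :: u)).
by rewrite [RHS]mulrS (FS [::]).
Qed.

Lemma swap_invariant_insert_sum x F : swap_invariant F ->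
  swap_invariant (insert_sum x F).
Proof.
move=> FS u y z v; rewrite !insert_sum_swap//.
by rewrite -!cat_cons FS !size_cat.
Qed.

Lemma arrangements_sum_swap F s : swap_invariant F ->
  arrangements_sum F s = F s *+ (size s)`!.
Proof.
elim: s F => [|x s IH] F FS //=.
by rewrite IH; [rewrite insert_sum_swap// factS mulrnA|exact: swap_invariant_insert_sum].
Qed.

Lemma insert_sumE x F s :
  insert_sum x F s = \sum_(i < (size s).+1) F (take i s ++ x :: drop i s).
Proof.
elim: s F => [|y s IH] F /=; first by rewrite big_ord1 addr0.
by rewrite IH [RHS]big_ord_recl.
Qed.

End concatenation_product.

(** * Permutations of arguments as rearrangements of lists *)

Lemma lift_perm_inj n (i j : 'I_n.+1) : injective (lift_perm i j).
Proof.
move=> s t st; apply/permP => k; apply: (@lift_inj _ j).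
by rewrite -!(lift_perm_lift i) st.
Qed.

Lemma lift_perm_surj n (i j : 'I_n.+1) (s : 'S_n.+1) :
  s i = j -> exists t, s = lift_perm i j t.
Proof.
move=> si; have nj k : j != s (lift i k).
  by rewrite -si (inj_eq perm_inj) neq_lift.
(* By [nj] the [unlift] always succeeds, so the default [k] is never taken. *)
pose t k := odflt k (unlift j (s (lift i k))).
have tE k : lift j (t k) = s (lift i k).
  by rewrite /t; have [h -> ->] := unlift_some (nj k).
have t_inj : injective t.
  by move=> a b ab; apply/(@lift_inj _ i)/(@perm_inj _ s); rewrite -!tE ab.
exists (perm t_inj); apply/permP => k; case: (unliftP i k) => [h|] ->.
  by rewrite lift_perm_lift permE tE.
by rewrite lift_perm_id.
Qed.

Section listing.
Context {A : Type}.

Definition listing n (X : 'I_n -> A) : seq A := [seq X i | i <- enum 'I_n].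

Lemma size_listing n (X : 'I_n -> A) : size (listing X) = n.
Proof. by rewrite size_map size_enum_ord. Qed.

Lemma listingS n (X : 'I_n.+1 -> A) :
  listing X = X ord0 :: listing (fun i => X (lift ord0 i)).
Proof. by rewrite /listing enum_ordSl /= -map_comp. Qed.

Lemma nth_listing x0 n (X : 'I_n -> A) (i : 'I_n) : nth x0 (listing X) i = X i.
Proof. by rewrite (nth_map i) ?size_enum_ord ?nth_ord_enum. Qed.

Lemma subst_deriv_listing (K : comPzRingType) (E : A -> A) n F (X : 'I_n -> A) :
  subst_deriv E F (listing X) =
  \sum_(i < n) F (listing (fun l => if l == i then E (X i) else X l)) :> K.
Proof.
elim: n F X => [|n IH] F X; first by rewrite big_ord0 /listing enum_ord0.
rewrite big_ord_recl listingS /= IH; congr (_ + _).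
  by rewrite listingS eqxx.
by apply: eq_bigr => i _; rewrite listingS.
Qed.

(** The permutation takes the value [ord0] at [i] and acts as [s] elsewhere, so it inserts the first
    argument at place [i] of the tail arranged by [s]. *)
Lemma listing_lift n (X : 'I_n.+1 -> A) (i : 'I_n.+1) (s : 'S_n) :
  listing (fun l => X (lift_perm i ord0 s l)) =
  take i (listing (fun l => X (lift ord0 (s l)))) ++
  X ord0 :: drop i (listing (fun l => X (lift ord0 (s l)))).
Proof.
have le_in : (i <= n)%N by rewrite -ltnS.
apply: (@eq_from_nth _ (X ord0)) => [|k].
  by rewrite size_cat /= size_takel ?size_drop !size_listing// addnS subnKC.
rewrite size_listing => kn; rewrite -[k]/(val (Ordinal kn)) nth_listing nth_cat.
rewrite size_takel ?size_listing//.
case: (unliftP i (Ordinal kn)) => [j|] ->; last first.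
  by rewrite lift_perm_id ltnn subnn.
rewrite lift_perm_lift /= /bump; case: (leqP i j) => ij.
  rewrite add1n ltnNge (leq_trans ij)//= subSn//= nth_drop subnKC//.
  by rewrite nth_listing.
by rewrite add0n ij nth_take// nth_listing.
Qed.

Lemma arrangements_sum_listing (K : comPzRingType) n F (X : 'I_n -> A) :
  arrangements_sum F (listing X) =
  \sum_(s : 'S_n) F (listing (fun l => X (s l))) :> K.
Proof.
elim: n F X => [|n IH] F X.
  rewrite (bigD1 1%g)//= big1 => [|s]; first by rewrite addr0 /listing enum_ord0.
  by move/eqP; case; apply/permP => -[].
rewrite listingS /= IH.
under eq_bigr do rewrite insert_sumE size_listing.
(* Permutations are sorted by the place [i] where they take the value [ord0]; each class is a copy
   of the smaller symmetric group through [lift_perm i ord0]. *)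
rewrite exchange_big /= (partition_big (fun s : 'S_n.+1 => (s^-1)%g ord0) xpredT)//=.
apply: eq_bigr => i _; rewrite (eq_bigl [in lift_perm i ord0 @: [set: 'S_n]%SET]).
  rewrite big_imset /=; last by move=> s t _ _; exact: lift_perm_inj.
  by apply: eq_big => [s|s _]; rewrite ?finset.in_setT// listing_lift.
move=> s; apply/eqP/imsetP => [si|[t _ ->]].
  have [|t ->] := @lift_perm_surj _ i ord0 s; first by rewrite -si permKV.
  by exists t.
by apply: (@perm_inj _ (lift_perm i ord0 t)); rewrite permKV lift_perm_id.
Qed.

End listing.

(** * Concatenation powers as sums over consecutive blocks *)

Section blocks.
Context {A : Type} {K : comPzRingType}.
Implicit Types (F G : seq A -> K) (s t : seq A).

Lemma concE F G s :
  conc F G s = \sum_(i < (size s).+1) F (take i s) * G (drop i s).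
Proof.
elim: s F => [|x s IH] F /=; first by rewrite big_ord1 addr0.
by rewrite IH [RHS]big_ord_recl.
Qed.

Lemma sum_ffun_ordS B j (P : pred {ffun 'I_j.+1 -> 'I_B})
    (Phi : {ffun 'I_j.+1 -> 'I_B} -> K) :
  let glue (a : 'I_B) (k : {ffun 'I_j -> 'I_B}) :=
    [ffun i => if unlift ord0 i is Some h then k h else a] in
  \sum_(k | P k) Phi k = \sum_(a < B) \sum_(k | P (glue a k)) Phi (glue a k).
Proof.
move=> glue; rewrite (reindex (fun p => glue p.1 p.2)) ?pair_big_dep//=.
exists (fun k => (k ord0, [ffun i => k (lift ord0 i)])) => [[a k] _|k _] /=.
  congr pair; first by rewrite ffunE unlift_none.
  by apply/ffunP => i; rewrite !ffunE liftK.
by apply/ffunP => i; rewrite ffunE; case: unliftP => [h|] ->; rewrite ?ffunE.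
Qed.

(** The power cuts [s] into [j] consecutive blocks. As [F] vanishes on the empty list, only nonempty
    blocks count, and their lengths are written [(k i).+1]; [B] makes the index type finite. *)
Lemma conc_pow_blocks B F j s : F [::] = 0 -> (size s <= B)%N ->
  conc_pow F j s =
  \sum_(k : {ffun 'I_j -> 'I_B} | (\sum_(i < j) (k i).+1 == size s)%N)
    \prod_(i < j) F (take (k i).+1 (drop (\sum_(h < j | (h < i)%N) (k h).+1) s)).
Proof.
move=> F0; elim: j s => [|j IH] s sB.
  under eq_bigr do rewrite big_ord0.
  under eq_bigl do rewrite big_ord0.
  case: s {sB} => [|x s] /=; last by rewrite big_pred0_eq.
  rewrite (big_pred1 (ffun0 (card_ord 0)))// => k.
  by apply/esym/eqP/ffunP => -[].
rewrite sum_ffun_ordS /= concE big_ord_recl take0 F0 mul0r add0r.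
under [RHS]eq_bigr => a _.
  under eq_bigl => k.
    rewrite big_ord_recl ffunE unlift_none.
    under eq_bigr do rewrite ffunE liftK.
    over.
  under eq_bigr => k _.
    rewrite big_ord_recl ffunE unlift_none big_pred0// drop0.
    under eq_bigr => i _.
      rewrite ffunE liftK big_mkcond big_ord_recl /= ffunE unlift_none.
      under eq_bigr do rewrite ffunE liftK /bump /= !add1n ltnS.
      rewrite -big_mkcond addnC -drop_drop.
      over.
    over.
  over.
transitivity (\sum_(a < B | (a < size s)%N) F (take a.+1 s) * conc_pow F j (drop a.+1 s)).
  rewrite (big_ord_widen_cond B xpredT (fun a => F (take a.+1 s) * conc_pow F j (drop a.+1 s)))//.
(* If the first block overruns [s], no [k] on the right has the required total length. *)
rewrite big_mkcond; apply: eq_bigr => a _; case: ifPn => [als|]; last first.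
  rewrite -leqNgt => sa; rewrite big_pred0// => k.
  by apply/eqP => e; move: sa; rewrite -e leqNgt ltnS leq_addr.
rewrite IH ?size_drop; last by rewrite (leq_trans _ sB)// leq_subr.
rewrite big_distrr /=; apply: eq_bigl => k.
by rewrite -(eqn_add2l a.+1) subnKC.
Qed.

End blocks.

(** * Smooth functions of a real variable *)

Section smooth_real.
Context {R : realType}.
Implicit Types (g h : R -> R) (s t : R).

Fixpoint times_derivable n g : Prop :=
  if n is m.+1 then (forall t, derivable g t 1) /\ times_derivable m (derive1 g) else True.

Definition smoothR g := forall n, times_derivable n g.

Lemma smoothR_derivable g t : smoothR g -> derivable g t 1.
Proof. by move=> /(_ 1%N)[]. Qed.

Lemma smoothR_is_derive g t : smoothR g -> is_derive t 1 g (derive1 g t).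
Proof. by move=> sg; rewrite derive1E; exact/derivableP/smoothR_derivable. Qed.

Lemma smoothR_derive1 g : smoothR g -> smoothR (derive1 g).
Proof. by move=> sg n; have [] := sg n.+1. Qed.

Lemma smoothR_derive1n n g : smoothR g -> smoothR (derive1n n g).
Proof. by move=> sg; elim: n => //= n; exact: smoothR_derive1. Qed.

Lemma derive1_eq g h : (forall t, is_derive t 1 g (h t)) -> derive1 g = h.
Proof. by move=> gh; apply/funext => t; rewrite derive1E; apply: derive_val. Qed.

Lemma times_derivableS n g h : (forall t, is_derive t 1 g (h t)) ->
  times_derivable n h -> times_derivable n.+1 g.
Proof. by move=> gh hn; split=> [t|]; [exact: ex_derive|rewrite (derive1_eq gh)]. Qed.

Lemma times_derivableW n g : times_derivable n.+1 g -> times_derivable n g.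
Proof. by elim: n g => [//|n IH] g [dg /IH]. Qed.

Lemma times_derivable_is_derive n g t : times_derivable n.+1 g ->
  is_derive t 1 g (derive1 g t).
Proof. by move=> [dg _]; rewrite derive1E; exact/derivableP. Qed.

(** Smoothness is proved by exhibiting all the derivatives at once, as is done for difference
    quotients, moments and cumulants. *)
Lemma smoothR_chain (G : nat -> R -> R) :
  (forall n t, is_derive t 1 (G n) (G n.+1 t)) -> smoothR (G 0).
Proof.
move=> GS n; suff: forall k, times_derivable n (G k) by exact.
elim: n => [//|n IH] k; exact: times_derivableS (GS k) (IH k.+1).
Qed.

Lemma smoothR_cst c : smoothR (cst c).
Proof.
move=> n; elim: n c => [//|n IH] c.
by apply: (@times_derivableS _ _ (cst 0)) => // t.
Qed.

Lemma times_derivableD n g h : times_derivable n g -> times_derivable n h ->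
  times_derivable n (fun t => g t + h t).
Proof.
elim: n g h => [//|n IH] g h gn hn.
apply: (@times_derivableS _ _ (fun t => derive1 g t + derive1 h t)) => [t|].
  exact: (is_deriveD (times_derivable_is_derive t gn) (times_derivable_is_derive t hn)).
exact: IH gn.2 hn.2.
Qed.

Lemma times_derivableM n g h : times_derivable n g -> times_derivable n h ->
  times_derivable n (fun t => g t * h t).
Proof.
elim: n g h => [//|n IH] g h gn hn.
apply: (@times_derivableS _ _ (fun t => g t * derive1 h t + h t * derive1 g t)) => [t|].
  exact: (is_deriveM (times_derivable_is_derive t gn) (times_derivable_is_derive t hn)).
apply: times_derivableD; apply: IH => //; try exact: times_derivableW.
- exact: hn.2.
- exact: gn.2.
Qed.

Lemma smoothRM g h : smoothR g -> smoothR h -> smoothR (fun t => g t * h t).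
Proof. by move=> sg sh n; exact: times_derivableM. Qed.

(** The derivative of 1/g is -g' (1/g)(1/g), which involves 1/g only to one order less. *)
Lemma smoothRV g : (forall t, g t != 0) -> smoothR g -> smoothR (fun t => (g t)^-1).
Proof.
move=> g0 sg n; elim: n => [//|n IH].
have dV t : is_derive t 1 (fun t => (g t)^-1) (- derive1 g t * ((g t)^-1 * (g t)^-1)).
  apply: (is_derive_eq (is_deriveV (g0 t) (smoothR_is_derive t sg))).
  rewrite /GRing.scale/= expr2 invfM; ring.
refine (times_derivableS dV _).
apply: times_derivableM; last exact: times_derivableM.
rewrite (_ : (fun t => _) = fun t => -1 * derive1 g t); last first.
  by apply/funext => t; rewrite mulN1r.
apply: times_derivableM; first exact: smoothR_cst.
exact: smoothR_derive1.
Qed.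

Lemma smoothR_continuous g : smoothR g -> continuous g.
Proof.
by move=> sg t; apply/differentiable_continuous/derivable1_diffP/smoothR_derivable.
Qed.

End smooth_real.

Lemma is_derive_center {R : realType} (a s : R) : is_derive s 1 (fun r => r - a) 1.
Proof.
by apply: is_derive_eq (is_deriveB (is_derive_id s 1) (is_derive_cst a s 1)) _; exact: subr0.
Qed.

Lemma is_derive_centerX {R : realType} (a s : R) n :
  is_derive s 1 (fun r => (r - a) ^+ n.+1) (n.+1%:R * (s - a) ^+ n).
Proof.
elim: n => [|n IH]; first by rewrite expr0 mulr1; exact: is_derive_center.
rewrite (_ : (fun r => _) = (fun r => (r - a) ^+ n.+1 * (r - a))); last first.
  by apply/funext => r; rewrite exprSr.
apply: (is_derive_eq (is_deriveM IH (is_derive_center a s))).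
by rewrite /GRing.scale/= -natr1 exprS; ring.
Qed.

(** * Hadamard's lemma in one variable *)

Section hadamard.
Context {R : realType}.
Variables (g : R -> R) (t0 : R).
Hypothesis sg : smoothR g.
Let G (n : nat) : R -> R := derive1n n g.

Let dG (n : nat) (t : R) : is_derive t 1 (G n) (G n.+1 t).
Proof. by rewrite /G derive1nS; exact/smoothR_is_derive/smoothR_derive1n. Qed.

(* [quot n] is the n-th derivative of [(g s - g t0) / (s - t0)]; the numerators
   come from differentiating [(s - t0) * quot 0 s = g s - g t0]. *)
Let quot := fix quot n s : R := if s == t0 then G n.+1 t0 / n.+1%:R else
  (if n is m.+1 then G n s - n%:R * quot m s else G 0 s - G 0 t0) / (s - t0).

(* [rem n s = (s - t0)^(n+1) * quot n s], but differentiable by construction *)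
Let rem := fix rem n s : R := if n is m.+1 then
  (s - t0) ^+ n * G n s - n%:R * rem m s else G 0 s - G 0 t0.

Let quotE (n : nat) (s : R) : s != t0 -> (s - t0) * quot n s =
  if n is m.+1 then G n s - n%:R * quot m s else G 0 s - G 0 t0.
Proof.
by move=> st; case: n => [|n] /=; rewrite (negbTE st) mulrC divfK// subr_eq0.
Qed.

Let remE (n : nat) (s : R) : rem n s = (s - t0) ^+ n.+1 * quot n s.
Proof.
have [->|st] := eqVneq s t0.
  rewrite subrr expr0n mul0r; elim: n => [|n IH] /=; first by rewrite subrr.
  by rewrite IH subrr expr0n mul0r mulr0 subrr.
elim: n => [|n IH]; first by rewrite expr1 quotE.
by rewrite exprSr -mulrA quotE//= IH mulrBr; ring.
Qed.

Let rem0 n : rem n t0 = 0.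
Proof. by rewrite remE subrr expr0n mul0r. Qed.

(** In the product rule, the term that differentiates the power cancels against the derivative of
    [rem] one order lower. *)
Let drem (n : nat) (s : R) : is_derive s 1 (rem n) ((s - t0) ^+ n * G n.+1 s).
Proof.
elim: n => [|n IH].
  apply: (is_derive_eq (is_deriveB (dG 0 s) (is_derive_cst (G 0 t0) s 1))).
  by rewrite subr0 expr0 mul1r.
apply: (is_derive_eq (is_deriveB (is_deriveM (is_derive_centerX t0 s n) (dG n.+1 s))
                     (is_deriveZ n.+1%:R IH))).
by rewrite /GRing.scale/=; ring.
Qed.

Let quot_continuous n : {for t0, continuous (quot n)}.
Proof.
have quott0 : quot n t0 = G n.+1 t0 / n.+1%:R by case: (n) => [|m] /=; rewrite eqxx.
have cG : {for t0, continuous (G n.+1)}.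
  exact/smoothR_continuous/smoothR_derive1n.
apply/(@cvgrPdist_le _ R^o) => e e0; rewrite quott0.
move/(@cvgrPdist_le _ R^o)/(_ e e0): cG => [del /= del0 Gdel].
exists del => //= s ts.
have [->|st] := eqVneq s t0; first by rewrite quott0 subrr normr0 ltW.
set c := G n.+1 t0 in Gdel *.
(* By [remE], [q s] is [(s - t0) ^+ n.+1] times the increment of [quot n] from [t0] to [s]. The mean
   value theorem bounds [q], because the second factor of its derivative is small near [t0]. *)
pose q s := rem n s - c / n.+1%:R * (s - t0) ^+ n.+1.
have dq (r : R) : is_derive r 1 q ((r - t0) ^+ n * (G n.+1 r - c)).
  apply: (is_derive_eq (is_deriveB (drem n r)
    (is_deriveZ (c / n.+1%:R) (is_derive_centerX t0 r n)))).
  by rewrite /GRing.scale/= mulrA divfK ?pnatr_eq0// mulrBr [c * _]mulrC.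
have cq : continuous q.
  by move=> r; apply/differentiable_continuous/derivable1_diffP; case: (dq r).
have q0 : q t0 = 0 by rewrite /q rem0 subrr expr0n mulr0 subrr.
have [r rt qs] : exists2 r, `|r - t0| <= `|s - t0| &
    q s = (r - t0) ^+ n * (G n.+1 r - c) * (s - t0).
  case: (ltgtP s t0) st => // st _.
    have [r rI e1] := MVT st (fun r _ => dq r) (continuous_subspaceT cq).
    exists r; first by move: rI; rewrite in_itv/= => /andP[? ?]; rewrite !ltr0_norm; lra.
    by move: e1; rewrite q0; lra.
  have [r rI e1] := MVT st (fun r _ => dq r) (continuous_subspaceT cq).
  exists r; first by move: rI; rewrite in_itv/= => /andP[? ?]; rewrite !gtr0_norm; lra.
  by rewrite -e1 q0 subr0.
have Gr : `|c - G n.+1 r| <= e.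
  by apply: Gdel; rewrite /= distrC (le_lt_trans rt)// distrC.
have st' : 0 < `|s - t0| ^+ n.+1 by rewrite exprn_gt0// normr_gt0 subr_eq0.
rewrite -(ler_pM2l st') -normrX -normrM mulrBr -remE mulrC -opprB normrN -/(q s) qs.
rewrite !normrM !normrX (distrC _ c) exprSr mulrAC.
apply: ler_pM => //.
by rewrite ler_wpM2r ?normr_ge0 ?lerXn2r ?nnegrE ?normr_ge0.
Qed.

Let dquot_ne (n : nat) (s : R) : s != t0 -> is_derive s 1 (quot n) (quot n.+1 s).
Proof.
move=> st; have nst : \forall r \near s, r != t0 by exact: open_neq.
have st0 : s - t0 != 0 by rewrite subr_eq0.
have dV : is_derive s 1 (fun r : R => (r - t0)^-1) (- (s - t0) ^- 2).
  apply: (is_derive_eq (@is_deriveV _ (fun r => r - t0) s _ _ st0 (is_derive_center t0 s))).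
  by rewrite /GRing.scale/= mulr1.
(* The quotient rule for p / (r - t0) gives (p' - [quot m s]) / (s - t0), so the numerators
   decide. *)
have main m (p : R -> R) p' : is_derive s 1 p p' ->
    (forall r, r != t0 -> quot m r = p r / (r - t0)) ->
    p' - quot m s = (s - t0) * quot m.+1 s ->
    is_derive s 1 (quot m) (quot m.+1 s).
  move=> dp qp e.
  apply: (@near_eq_is_derive _ _ _ (fun r => p r * (r - t0)^-1)).
    by apply: filterS nst => r rt; rewrite qp.
  apply: (is_derive_eq (is_deriveM dp dV)).
  apply: (mulfI st0); rewrite -e qp//.
  by rewrite /GRing.scale/=; field.
elim: n => [|n IH].
  apply: (main 0 (fun r => G 0 r - G 0 t0) (G 1 s)).
  - apply: (is_derive_eq (is_deriveB (dG 0 s) (is_derive_cst (G 0 t0) s 1))).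
    by rewrite subr0.
  - by move=> r /negbTE /= ->.
  - by rewrite quotE// mul1r.
apply: (main n.+1 (fun r => G n.+1 r - n.+1%:R * quot n r) (G n.+2 s - n.+1%:R * quot n.+1 s)).
- exact: (is_deriveB (dG n.+1 s) (is_deriveZ n.+1%:R IH)).
- by move=> r /negbTE /= ->.
- by rewrite quotE// -[n.+2%:R]natr1; ring.
Qed.

Let dquot (n : nat) (s : R) : is_derive s 1 (quot n) (quot n.+1 s).
Proof.
have [->|] := eqVneq s t0; last exact: dquot_ne.
apply/is_derive1_caratheodory.
have /is_derive1_caratheodory[p [pE cp pt]] := dG n.+1 t0.
have quott0 m : quot m t0 = G m.+1 t0 / m.+1%:R by case: m => [|m] /=; rewrite eqxx.
(* This slope comes from solving [(s - t0) * quot n.+1 s = G n.+1 s - n.+1%:R * quot n s] for the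
   increment of [quot n], with [p] the slope of [G n.+1]. Its continuity at [t0] rests on
   [quot_continuous]. *)
exists (fun s => (p s - quot n.+1 s) / n.+1%:R); split.
- move=> z; have [->|zt] := eqVneq z t0; first by rewrite !subrr mulr0.
  have n0 : n.+1%:R != 0 :> R by rewrite pnatr_eq0.
  have Gz : n.+1%:R * (quot n z - quot n t0) = (p z - quot n.+1 z) * (z - t0).
    have qz : (z - t0) * quot n.+1 z = G n.+1 z - n.+1%:R * quot n z := quotE n.+1 zt.
    by rewrite mulrBl -pE [quot n.+1 z * _]mulrC qz quott0 mulrBr mulrCA divff//; ring.
  by apply: (mulfI n0); rewrite Gz mulrAC mulrCA divff// mulr1.
- apply: continuousM; last exact: cst_continuous.
  by apply: continuousB.
- by rewrite pt !quott0 -!natr1; field; rewrite !natr1 !pnatr_eq0.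
Qed.

Lemma hadamard : exists2 h : R -> R, smoothR h &
  (forall s, g s - g t0 = (s - t0) * h s) /\ h t0 = derive1 g t0.
Proof.
exists (quot 0); first exact: (smoothR_chain dquot).
split=> [s|]; last by rewrite /= eqxx divr1.
have [->|st] := eqVneq s t0; first by rewrite !subrr mul0r.
by rewrite quotE.
Qed.

End hadamard.

(** * Derivations of the algebra of smooth functions *)

Lemma derive_line {R : numFieldType} {V W : normedModType R} (g : V -> W) x v :
  'D_v g x = 'D_1 (fun r : R => g (r *: v + x)) 0.
Proof.
rewrite /derive; set q1 := fun r => r^-1 *: _; set q2 := fun r => r^-1 *: _.
suff -> : q1 = q2 by [].
by apply/funext => r; rewrite /q1 /q2 /= addr0 scale0r add0r [_%:A]mulr1.
Qed.

(** Only a directional derivative of [g] is given, so everything is restricted to the line through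
    [x] and the one-variable chain rule applies. *)
Lemma is_derive_comp {R : realType} {V : normedModType R} (phi : R -> R)
    (g : V -> R) x v dphi dg :
  is_derive (g x) 1 phi dphi -> is_derive x v g dg ->
  is_derive x v (phi \o g) (dphi * dg).
Proof.
move=> Dphi [/derivable1P Dg <-].
have Dg0 : is_derive (0 : R) 1 (fun r => g (r *: v + x)) ('D_v g x).
  by apply: DeriveDef => //; exact/esym/derive_line.
have Dphi0 : is_derive (g (0 *: v + x)) 1 phi dphi by rewrite scale0r add0r.
have [dpg Dpg] := is_derive1_comp Dphi0 Dg0.
by apply: DeriveDef; [exact/derivable1P|rewrite -Dpg; exact: derive_line].
Qed.

Section smooth_composition.
Context {R : realType} {d : nat}.

Lemma Ck_on_comp k (U : set 'rV[R]_d) (phi : R -> R) g :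
  open U -> smoothR phi -> Ck_on k U g -> Ck_on k U (phi \o g).
Proof.
move=> oU; elim: k phi g => [|k IH] phi g sphi gk.
  split=> // x Ux; apply: continuous_comp; first exact: gk.1.
  exact: smoothR_continuous.
split=> [x Ux|i].
  by apply: continuous_comp; [exact: gk.1|exact: smoothR_continuous].
have [dg Dgk] := gk.2 i.
have Dpg x : U x -> is_derive x (delta_mx 0 i) (phi \o g)
    (derive1 phi (g x) * 'D_(delta_mx 0 i) g x).
  by move=> Ux; apply: is_derive_comp; [exact: smoothR_is_derive|exact/derivableP/dg].
split=> [x /Dpg[]//|].
apply: Ck_on_eq oU _ (Ck_onM oU (IH _ _ (smoothR_derive1 sphi) (Ck_onW gk)) Dgk).
by move=> x; rewrite inE => /Dpg[_ ->].
Qed.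

Variables (M : smoothManifold R d) (theta : smoothFun M).

Lemma smooth_comp_subproof (phi : R -> R) :
  smoothR phi -> (phi \o theta : M -> R) \in @smooth R d M.
Proof.
case: theta => g /=; rewrite !inE => sg sphi c Ac k.
have [_ oU _ _ _] := atlas_homeo Ac.
exact: Ck_on_comp oU sphi (sg c Ac k).
Qed.

Definition smooth_comp phi (sphi : smoothR phi) : smoothFun M :=
  SmoothFun (smooth_comp_subproof sphi).

End smooth_composition.

Section vfield_theory.
Context {R : realType} {d : nat} {M : smoothManifold R d}.
Implicit Types (X Y : vfield M) (g h : smoothFun M).

Lemma vfieldZD X (a : R) g h : X (a *: g + h) = a *: (X g : smoothFun M) + X h.
Proof. by case: X => X /=; rewrite inE => -[]. Qed.

Lemma vfieldM X g h : X (g * h) = (X g : smoothFun M) * h + g * X h.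
Proof. by case: X => X /=; rewrite inE => -[]. Qed.

Lemma vfieldD X g h : X (g + h) = (X g : smoothFun M) + X h.
Proof. by have := vfieldZD X 1 g h; rewrite !scale1r. Qed.

Lemma vfield0 X : X 0 = 0 :> smoothFun M.
Proof.
have := vfieldD X 0 0; rewrite addr0.
by move/(congr1 (fun g : smoothFun M => g - X 0)); rewrite subrr addrK.
Qed.

Lemma vfieldN X g : X (- g) = - (X g : smoothFun M).
Proof. by apply/eqP; rewrite -addr_eq0 -vfieldD addNr vfield0. Qed.

Lemma vfieldDl X Y g : (X + Y) g = (X g : smoothFun M) + Y g.
Proof. by []. Qed.

Lemma vfield_sum X n (F : 'I_n -> smoothFun M) :
  X (\sum_(i < n) F i) = \sum_(i < n) (X (F i) : smoothFun M).
Proof. exact: (big_morph (X : _ -> smoothFun M) (vfieldD X) (vfield0 X)). Qed.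

Lemma vfieldZ X (a : R) g : X (a *: g) = a *: (X g : smoothFun M).
Proof. by rewrite -[a *: g]addr0 vfieldZD vfield0 addr0. Qed.

Lemma vfield1 X : X 1 = 0 :> smoothFun M.
Proof.
have := vfieldM X 1 1; rewrite !mulr1 mul1r.
by move/(congr1 (fun g : smoothFun M => g - X 1)); rewrite subrr addrK.
Qed.

Lemma smoothFun1 (x : M) : (1 : smoothFun M) x = 1. Proof. by []. Qed.

Lemma smoothFun0 (x : M) : (0 : smoothFun M) x = 0. Proof. by []. Qed.

(* With [phi s - phi t0 = (s - t0) h s] the Leibniz rule gives the value at a
   point over [t0], so derivations need not be known to be local. *)
Lemma vfield_comp X (theta : smoothFun M) phi (sphi : smoothR phi) :
  X (smooth_comp theta sphi) =
  smooth_comp theta (smoothR_derive1 sphi) * X theta :> smoothFun M.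
Proof.
apply: smoothFun_eqP => x; have [h sh [hE h0]] := hadamard (theta x) sphi.
have -> : smooth_comp theta sphi = phi (theta x) *: (1 : smoothFun M) +
    (theta - theta x *: (1 : smoothFun M)) * smooth_comp theta sh.
  apply: smoothFun_eqP => y; rewrite !smoothFunE smoothFun1 !mulr1 /=.
  by rewrite -hE addrC subrK.
rewrite vfieldZD vfield1 vfieldM vfieldD vfieldN vfieldZ vfield1.
by rewrite !smoothFunE smoothFun1 smoothFun0 /= -h0; ring.
Qed.

End vfield_theory.

(** * Moments and cumulants *)

Lemma continuous_borel_measurable {R : realType} {N : ptopologicalType}
  (f : N -> R) : continuous f -> measurable_fun setT (f : borel N -> R).
Proof.
move=> /continuousP cf; apply: (measurability _ (RGenOpens.measurableE R)).
move=> _ [_ [a [b ->] <-]]; rewrite setTI; apply: sub_sigma_algebra.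
exact/cf/interval_open.
Qed.

Section exponential_moments.
Context {R : realType} {N : ptopologicalType}.
Variables (nu : {measure set (borel N) -> \bar R}) (f : N -> R) (b : R).
Implicit Types (t s : R) (k n : nat) (g h : N -> R -> R).
Hypotheses (nu_neq0 : nu setT != 0%E) (nu_fin : (nu setT < +oo)%E).
Hypotheses (mf : measurable_fun setT (f : borel N -> R)).
Hypotheses (fb : forall x, `|f x| <= b).

(** Unnormalised: the k-th derivative of the partition function. Expectations become ratios with
    [moment 0]. *)
Definition moment k t := \int[nu]_x (f x ^+ k * expR (t * f x)).

Let integrable_bounded (h : N -> R) (c : R) : measurable_fun setT (h : borel N -> R) ->
  (forall x, `|h x| <= c) -> nu.-integrable setT (EFin \o h).
Proof.
move=> mh hc; apply: measurable_bounded_integrable => //.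
exists c; split; first exact: num_real.
by move=> y cy x _ /=; rewrite (le_trans (hc x))// ltW.
Qed.

Let moment_bound k t x : `|f x ^+ k * expR (t * f x)| <= b ^+ k * expR (`|t| * b).
Proof.
rewrite normrM normrX (ger0_norm (expR_ge0 _)); apply: ler_pM => //.
- by rewrite lerXn2r ?nnegrE//; exact: le_trans (normr_ge0 _) (fb x).
- rewrite ler_expR (le_trans (ler_norm _))// normrM ler_wpM2l//.
Qed.

Let measurable_moment k t :
  measurable_fun setT (fun x : borel N => f x ^+ k * expR (t * f x)).
Proof.
apply: measurable_funM; first exact: measurable_funX.
apply: measurableT_comp => //; exact: measurable_funM.
Qed.

Let integrable_moment k t :
  nu.-integrable setT (EFin \o fun x => f x ^+ k * expR (t * f x)).
Proof. exact: integrable_bounded (measurable_moment k t) (moment_bound k t). Qed.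

Lemma is_derive_moment k t : is_derive t 1 (moment k) (moment k.+1 t).
Proof.
pose F (s : R) x := f x ^+ k * expR (s * f x).
have dF (s : R) x : is_derive s 1 (F^~ x) (f x ^+ k.+1 * expR (s * f x)).
  have d1 : is_derive s 1 (fun r => r * f x) (f x).
    apply: (is_derive_eq (is_deriveM (is_derive_id s 1) (is_derive_cst (f x) s 1))).
    by rewrite /GRing.scale/= mulr0 mulr1 add0r.
  have d2 := @is_derive1_comp _ expR (fun r => r * f x) s _ _ (is_derive_expR (s * f x)) d1.
  apply: (is_derive_eq (is_deriveZ (f x ^+ k) d2)).
  by rewrite /GRing.scale/= exprSr; ring.
have d1F s x : partial1of2 F s x = f x ^+ k.+1 * expR (s * f x).
  by rewrite partial1of2E; exact: derive_val.
(* A bound for the parameter derivative, uniform on the unit neighbourhood of [t]; as a constant it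
   is integrable because [nu] is finite. *)
pose c := b ^+ k.+1 * expR ((`|t| + 1) * b).
have b0 : 0 <= b by exact: le_trans (normr_ge0 _) (fb point).
have c0 : 0 <= c by rewrite mulr_ge0 ?exprn_ge0 ?expR_ge0.
have It : `]t - 1, t + 1[%classic t by rewrite /= in_itv/=; lra.
have HI (s : R) : `]t - 1, t + 1[%classic s -> nu.-integrable setT (EFin \o F s).
  by move=> _; exact: integrable_moment.
have HD (s : R) x : `]t - 1, t + 1[%classic s -> setT x -> derivable (F^~ x) s 1.
  by move=> _ _; case: (dF s x).
have HG : nu.-integrable setT (EFin \o (fun=> c) : borel N -> \bar R).
  by apply: (@integrable_bounded (fun=> c) c) => // x; rewrite ger0_norm.
have HB s x : `]t - 1, t + 1[%classic s -> setT x -> `|partial1of2 F s x| <= c.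
  rewrite /= in_itv/= => /andP[st ts] _; rewrite d1F.
  apply: (le_trans (moment_bound k.+1 s x)).
  rewrite ler_wpM2l ?exprn_ge0// ler_expR ler_wpM2r//.
  by rewrite ler_norml; have := ler_norm t; have := ler_norm (- t); rewrite normrN; lra.
apply: DeriveDef.
  exact: (derivable_under_integral measurableT It HI HD (fun=> c0) HG HB).
rewrite -derive1E (differentiation_under_integral measurableT It HI HD (fun=> c0) HG HB).
by apply: eq_Rintegral => x _; exact: d1F.
Qed.

Lemma smoothR_moment k : smoothR (moment k).
Proof.
exact: (@smoothR_chain _ (fun n => moment (n + k)) (fun n => is_derive_moment (n + k))).
Qed.

Lemma moment0_gt0 t : 0 < moment 0 t.
Proof.
(* A positive lower bound of the integrand, since |f| is at most [b]. *)
pose c := expR (- (`|t| * b)).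
have cnu : 0 < c * fine (nu setT).
  rewrite mulr_gt0 ?expR_gt0// fine_gt0// nu_fin andbT lt0e nu_neq0.
  exact: measure_ge0.
rewrite (lt_le_trans cnu)//.
have := @Rintegral_cst _ (borel N) R nu setT measurableT c.
move=> <-; apply: le_Rintegral => //.
- by apply: (@integrable_bounded (fun=> c) c) => // x; rewrite ger0_norm ?expR_ge0.
- move=> x _; rewrite expr0 mul1r ler_expR.
  have := ler_norm (- (t * f x)); rewrite normrN normrM.
  have := ler_wpM2l (normr_ge0 t) (fb x); lra.
Qed.

Let gibbsE t (h : N -> R) : nu.-integrable setT (EFin \o fun x => h x * expR (t * f x)) ->
  gibbs_mean nu f t h = (\int[nu]_x (h x * expR (t * f x))) / moment 0 t.
Proof.
move=> ih; rewrite -RintegralZr//; apply: eq_Rintegral => x _.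
rewrite expRB /log_partition lnK ?posrE.
  by rewrite mulrA; congr (_ / _); apply: eq_Rintegral => y _; rewrite expr0 mul1r.
have := moment0_gt0 t; congr (0 < _).
by apply: eq_Rintegral => y _; rewrite expr0 mul1r.
Qed.

Let gibbs_mono t (c : R) k : gibbs_mean nu f t (fun x => c * f x ^+ k) =
  c * (moment k t / moment 0 t).
Proof.
have e : (fun x => c * f x ^+ k * expR (t * f x)) =
    (fun x => c * (f x ^+ k * expR (t * f x))).
  by apply/funext => x; rewrite mulrA.
rewrite gibbsE e ?RintegralZl ?mulrA//.
exact: (integrableZl measurableT c (integrable_moment k t)).
Qed.

(** A class that contains every f_n and is stable under the recursion defining them. Means of its
    members are combinations of moment ratios with smooth coefficients, hence can be differentiated
    explicitly. *)
Inductive polynomial_in_f : (N -> R -> R) -> Prop :=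
| polynomial_mono c k : smoothR c -> polynomial_in_f (fun x t => c t * f x ^+ k)
| polynomial_add g h : polynomial_in_f g -> polynomial_in_f h ->
    polynomial_in_f (fun x t => g x t + h x t).

Let polynomial_integrable h t : polynomial_in_f h ->
  nu.-integrable setT (EFin \o fun x => h x t * expR (t * f x)).
Proof.
elim=> [c k sc|g1 g2 _ i1 _ i2].
  rewrite (_ : (EFin \o _) = (fun x => (c t)%:E * (f x ^+ k * expR (t * f x))%:E)%E).
    exact: (integrableZl measurableT (c t) (integrable_moment k t)).
  by apply/funext => x /=; rewrite -EFinM mulrA.
rewrite (_ : (EFin \o _) = (fun x =>
    (g1 x t * expR (t * f x))%:E + (g2 x t * expR (t * f x))%:E)%E).
  exact: (integrableD measurableT i1 i2).
by apply/funext => x /=; rewrite -EFinD mulrDl.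
Qed.

Let gibbsD g h t : polynomial_in_f g -> polynomial_in_f h ->
  gibbs_mean nu f t (fun x => g x t + h x t) =
  gibbs_mean nu f t (g^~ t) + gibbs_mean nu f t (h^~ t).
Proof.
move=> pg ph; rewrite !gibbsE; try exact: polynomial_integrable.
  rewrite -mulrDl -RintegralD//; try exact: polynomial_integrable.
  by congr (_ / _); apply: eq_Rintegral => x _; rewrite mulrDl.
exact: (polynomial_integrable t (polynomial_add pg ph)).
Qed.

Let mean t := gibbs_mean nu f t f.

Let meanE t : mean t = moment 1 t / moment 0 t.
Proof.
rewrite -[RHS]mul1r -gibbs_mono; congr gibbs_mean.
by apply/funext => x; rewrite mul1r.
Qed.

Let smoothR_ratio k : smoothR (fun t => moment k t / moment 0 t).
Proof.
apply: smoothRM; first exact: smoothR_moment.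
by apply: smoothRV; [move=> t; rewrite gt_eqF ?moment0_gt0|exact: smoothR_moment].
Qed.

Let smoothR_mean : smoothR mean.
Proof. by rewrite (_ : mean = fun t => moment 1 t / moment 0 t)//; exact/funext/meanE. Qed.

Lemma polynomial_fhatM h : polynomial_in_f h ->
  polynomial_in_f (fun x t => fhat nu f x t * h x t).
Proof.
elim=> [c k sc|g1 g2 _ p1 _ p2].
  rewrite (_ : (fun x t => _) = fun x t =>
      c t * f x ^+ k.+1 + (cst (-1) t * (mean t * c t)) * f x ^+ k).
    apply: polynomial_add; apply: polynomial_mono => //.
    by apply: smoothRM; [exact: smoothR_cst|exact: smoothRM].
  apply/funext => x; apply/funext => t; rewrite /fhat -/(mean t) exprS /cst; ring.
rewrite (_ : (fun x t => _) = fun x t => fhat nu f x t * g1 x t + fhat nu f x t * g2 x t).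
  exact: polynomial_add.
by apply/funext => x; apply/funext => t; rewrite mulrDr.
Qed.

Lemma polynomial_derive h : polynomial_in_f h ->
  polynomial_in_f (fun x => derive1 (h x)) /\ forall x t, derivable (h x) t 1.
Proof.
elim=> [c k sc|g1 g2 _ [p1 d1] _ [p2 d2]].
  have D x t : is_derive t 1 (fun t => c t * f x ^+ k) (derive1 c t * f x ^+ k).
    apply: (is_derive_eq (is_deriveM (smoothR_is_derive t sc) (is_derive_cst (f x ^+ k) t 1))).
    by rewrite /GRing.scale/= mulr0 add0r mulrC.
  split=> [|x t]; last by case: (D x t).
  rewrite (_ : (fun x => _) = fun x t => derive1 c t * f x ^+ k).
    exact/polynomial_mono/smoothR_derive1.
  by apply/funext => x; exact: derive1_eq (D x).
have D x t : is_derive t 1 (fun t => g1 x t + g2 x t) (derive1 (g1 x) t + derive1 (g2 x) t).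
  by rewrite !derive1E; exact: (is_deriveD (derivableP (d1 x t)) (derivableP (d2 x t))).
split=> [|x t]; last by case: (D x t).
rewrite (_ : (fun x => _) = fun x t => derive1 (g1 x) t + derive1 (g2 x) t).
  exact: polynomial_add.
by apply/funext => x; exact: derive1_eq (D x).
Qed.

(** The log-partition function has derivative E[f], so differentiating the density multiplies it by
    [fhat]. On monomials this becomes the quotient rule for moment ratios. *)
Lemma is_derive_gibbs_mean h t : polynomial_in_f h ->
  is_derive t 1 (fun s => gibbs_mean nu f s (h^~ s))
    (gibbs_mean nu f t (fun x => fhat nu f x t * h x t + derive1 (h x) t)).
Proof.
elim=> [c k sc|g1 g2 p1 D1 p2 D2].
  under eq_fun do rewrite gibbs_mono.
  have m0 : moment 0 t != 0 by rewrite gt_eqF ?moment0_gt0.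
  have D := is_deriveM (smoothR_is_derive t sc) (is_deriveM (is_derive_moment k t)
     (is_deriveV m0 (is_derive_moment 0 t))).
  apply: (is_derive_eq D).
  have sc' := smoothR_derive1 sc.
  pose sa := smoothRM (smoothR_cst (-1)) (smoothRM smoothR_mean sc).
  rewrite (_ : (fun x => _) = fun x => (c t * f x ^+ k.+1 +
      ((cst (-1) t * (mean t * c t)) * f x ^+ k + derive1 c t * f x ^+ k))).
    rewrite (gibbsD t (polynomial_mono k.+1 sc)
      (polynomial_add (polynomial_mono k sa) (polynomial_mono k sc'))).
    rewrite (gibbsD t (polynomial_mono k sa) (polynomial_mono k sc')).
    by rewrite !gibbs_mono meanE /cst /GRing.scale/= mulrfctE; field.
  apply/funext => x; rewrite /fhat -/(mean t) exprS /cst.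
  have -> : derive1 (fun s => c s * f x ^+ k) t = derive1 c t * f x ^+ k; last by ring.
  rewrite derive1E; apply: derive_val.
  apply: (is_derive_eq (is_deriveM (smoothR_is_derive t sc) (is_derive_cst (f x ^+ k) t 1))).
  by rewrite /GRing.scale/= mulr0 add0r mulrC.
have [dp1 d1] := polynomial_derive p1; have [dp2 d2] := polynomial_derive p2.
under eq_fun do rewrite gibbsD//.
apply: (is_derive_eq (is_deriveD D1 D2)).
rewrite -(gibbsD t (polynomial_add (polynomial_fhatM p1) dp1)
                   (polynomial_add (polynomial_fhatM p2) dp2)).
congr gibbs_mean; apply/funext => x.
rewrite mulrDr !derive1E (deriveD (d1 x t) (d2 x t)); ring.
Qed.

Lemma polynomial_fseq n : polynomial_in_f (fseq nu f n.+1).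
Proof.
have pf : polynomial_in_f (fun x _ => f x).
  rewrite (_ : (fun x _ => _) = fun x t => cst 1 t * f x ^+ 1).
    exact/polynomial_mono/smoothR_cst.
  by apply/funext => x; apply/funext => t; rewrite mul1r.
elim: n => [//|[_|n IH]] /=; last first.
  by apply: polynomial_add; [exact: polynomial_fhatM|exact: (polynomial_derive IH).1].
apply: (polynomial_fhatM (h := fhat nu f)).
rewrite (_ : fhat nu f = fun x t => f x + (cst (-1) t * mean t) * f x ^+ 0).
  apply: polynomial_add => //; apply: polynomial_mono.
  by apply: smoothRM => //; exact: smoothR_cst.
by apply/funext => x; apply/funext => t; rewrite /fhat /cst expr0 mulr1 mulN1r.
Qed.

(** From f_2 on, the recursion is exactly [is_derive_gibbs_mean]. For f_1 that rule yields [fhat]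
    times f instead of f_2, the square of [fhat]; their means agree because [fhat] has mean zero. *)
Lemma is_derive_mean_fseq n t :
  is_derive t 1 (fun s => gibbs_mean nu f s (fseq nu f n.+1 ^~ s))
    (gibbs_mean nu f t (fseq nu f n.+2 ^~ t)).
Proof.
have := is_derive_gibbs_mean t (polynomial_fseq n).
case: n => [|n] //= D; apply: (is_derive_eq D).
have s1 := smoothR_cst (1 : R); have s2 := smoothRM (smoothR_cst (-1)) smoothR_mean.
have s3 := smoothRM (smoothR_cst (-2)) smoothR_mean.
have s4 := smoothRM smoothR_mean smoothR_mean.
rewrite (_ : (fun x => _) = fun x => cst 1 t * f x ^+ 2 + (cst (-1) t * mean t) * f x ^+ 1).
  rewrite (gibbsD t (polynomial_mono 2 s1) (polynomial_mono 1 s2)).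
  rewrite [X in _ = gibbs_mean _ _ _ X](_ : _ = fun x => cst 1 t * f x ^+ 2 +
      ((cst (-2) t * mean t) * f x ^+ 1 + (mean t * mean t) * f x ^+ 0)).
    rewrite (gibbsD t (polynomial_mono 2 s1)
      (polynomial_add (polynomial_mono 1 s3) (polynomial_mono 0 s4))).
    rewrite (gibbsD t (polynomial_mono 1 s3) (polynomial_mono 0 s4)).
    have m0 : moment 0 t != 0 by rewrite gt_eqF ?moment0_gt0.
    by rewrite !gibbs_mono meanE /cst; field.
  by apply/funext => x; rewrite /fhat -/(mean t) /cst; ring.
apply/funext => x; rewrite derive1_cst /fhat -/(mean t) /cst; ring.
Qed.

Lemma is_derive_log_partition t :
  is_derive t 1 (log_partition nu f) (gibbs_mean nu f t (fseq nu f 1 ^~ t)).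
Proof.
rewrite -[gibbs_mean _ _ _ _]/(mean t) meanE mulrC.
have -> : log_partition nu f = fun t => ln (moment 0 t).
  apply/funext => s; congr ln; apply: eq_Rintegral => x _.
  by rewrite expr0 mul1r.
exact: (@is_derive1_comp _ (@ln R) (moment 0) t _ _
  (is_derive1_ln (moment0_gt0 t)) (is_derive_moment 0 t)).
Qed.

(** The cumulants of f under the tilted measure; index 0 holds the function whose successive
    derivatives they are. *)
Definition cumulant n t :=
  if n is m.+1 then gibbs_mean nu f t (fseq nu f m.+1 ^~ t) else log_partition nu f t.

Lemma is_derive_cumulant n t : is_derive t 1 (cumulant n) (cumulant n.+1 t).
Proof. by case: n => [|n]; [exact: is_derive_log_partition|exact: is_derive_mean_fseq]. Qed.

Lemma smoothR_cumulant n : smoothR (cumulant n).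
Proof.
exact: (@smoothR_chain _ (fun k => cumulant (k + n)) (fun k => is_derive_cumulant (k + n))).
Qed.

End exponential_moments.

(** * Iterated covariant differentials *)

Section covariant_differentials.
Context {R : realType} {d : nat} {M : smoothManifold R d} (D : connection M).
Implicit Types (X Y : vfield M) (g : smoothFun M) (s t : seq (vfield M)).

(* The value is 0 on lists of length other than [n], which makes additivity and
   symmetry hold without a length condition. *)
Fixpoint covdiff_list g n s : smoothFun M :=
  match n, s with
  | 0, [::] => g
  | m.+1, Y :: t => Y (covdiff_list g m t) - subst_deriv (D Y) (covdiff_list g m) t
  | _, _ => 0
  end.

Lemma covdiff_list_cons g n Y t : covdiff_list g n.+1 (Y :: t) =
  Y (covdiff_list g n t) - subst_deriv (D Y) (covdiff_list g n) t.
Proof. by []. Qed.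

Lemma covdiff_list_eq0 g n s : size s != n -> covdiff_list g n s = 0.
Proof.
elim: n s => [|n IH] [|Y s]//=; rewrite eqSS => sn.
rewrite IH// vfield0 (@eq_subst_deriv _ _ _ _ (fun=> 0)) ?subst_deriv0 ?subrr//.
by move=> u us; rewrite IH ?us.
Qed.

Lemma covdiff_listE g n (X : 'I_n -> vfield M) :
  covdiff_fun D g n X = covdiff_list g n (listing X).
Proof.
case: n X => [|n] X; first by rewrite /listing enum_ord0.
elim: n X => [|n IH] X; first by rewrite listingS /= /listing enum_ord0 subr0.
rewrite listingS covdiff_list_cons subst_deriv_listing -IH.
by congr (_ - _); apply: eq_bigr => i _; rewrite -IH.
Qed.

Lemma connectionDl X Y Z : D (X + Y) Z = D X Z + D Y Z.
Proof. by have := nablaPl D 1 X Y Z; rewrite !scale1r. Qed.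

Lemma covdiff_list_multiadditive g n : multiadditive (covdiff_list g n).
Proof.
elim: n => [|n IH] [|Z u] X Y s; rewrite ?cat0s ?cat_cons ?covdiff_list_cons ?addr0//.
  rewrite vfieldDl [RHS]addrACA -opprD -(subst_derivDl _ _ _ IH).
  congr (_ - _); elim: s (covdiff_list g n) => //= Z s IHs F.
  by rewrite connectionDl IHs.
rewrite IH vfieldD multiadditive_subst_deriv//; last exact: nablaDr.
by rewrite opprD addrACA.
Qed.

(** Expanded down to [F], the second differential can be compared with the one where [X] and [Y] are
    exchanged. *)
Lemma covdiff_list_cons2 g n X Y s : let F := covdiff_list g n in
  covdiff_list g n.+2 [:: X, Y & s] =
  X (Y (F s)) - X (subst_deriv (D Y) F s) -
  (D X Y (F s) - subst_deriv (D (D X Y)) F s +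
   (Y (subst_deriv (D X) F s) - subst_deriv (D X) (subst_deriv (D Y) F) s)).
Proof.
move=> F; have morphN : {morph (fun a : smoothFun M => - a) : a b / a + b} := @opprD _.
have morphY : {morph (fun a => Y a : smoothFun M) : a b / a + b} := vfieldD Y.
have -> : Y (subst_deriv (D X) F s) - subst_deriv (D X) (subst_deriv (D Y) F) s =
    subst_deriv (D X) (fun u => covdiff_list g n.+1 (Y :: u)) s.
  rewrite -(subst_deriv_morph _ _ _ (vfield0 Y) morphY).
  by rewrite -(subst_deriv_morph _ _ _ (oppr0 _) morphN) -subst_derivD.
by rewrite covdiff_list_cons subst_deriv_cons !(covdiff_list_cons _ n) vfieldD vfieldN.
Qed.

Hypotheses (torsionD : torsion_free D) (flatD : flat D).

(** A swap beyond the first slot is inherited from the previous order. Exchanging the first two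
    slots changes the second differential by curvature and torsion terms, which vanish. *)
Lemma covdiff_list_swap g n : swap_invariant (covdiff_list g n).
Proof.
elim: n => [|n IH] [|Z u] X Y s //; last first.
  by rewrite !cat_cons !covdiff_list_cons IH swap_invariant_subst_deriv.
case: n {IH} => [|n]; first by rewrite !covdiff_list_eq0.
rewrite !cat0s !covdiff_list_cons2; set F := covdiff_list g n.
have torsionE : D X Y = D Y X + bracket X Y by rewrite -torsionD addrC subrK.
have comm : subst_deriv (D X) (subst_deriv (D Y) F) s + subst_deriv (D (D X Y)) F s =
    subst_deriv (D Y) (subst_deriv (D X) F) s + subst_deriv (D (D Y X)) F s.
  apply: subst_deriv_comm => [|Z]; first exact: covdiff_list_multiadditive.
  have /eqP := flatD X Y Z; rewrite subr_eq0 subr_eq => /eqP ->.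
  by rewrite torsionE connectionDl addrCA [RHS]addrC; congr (_ + _); exact: addrC.
have bracketE : D X Y (F s) = D Y X (F s) + (X (Y (F s)) - Y (X (F s))) :> smoothFun M.
  by rewrite torsionE.
rewrite bracketE; move: comm.
set a := X (Y _) : smoothFun M; set b := Y (X _) : smoothFun M.
set c := subst_deriv (D X) (subst_deriv _ _) _; set e := subst_deriv (D (D X Y)) _ _.
set c' := subst_deriv (D Y) (subst_deriv _ _) _; set e' := subst_deriv (D (D Y X)) _ _.
set p := X _ : smoothFun M; set q := Y _ : smoothFun M; set r := D Y X _ : smoothFun M.
move=> comm.
transitivity (b - p - q - r + (c + e) : smoothFun M); first by ring.
by rewrite comm; ring.
Qed.

End covariant_differentials.

(** * Covariant differentials of a function of theta *)

Section covariant_faa_di_bruno.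
Context {R : realType} {d : nat} {M : smoothManifold R d} (D : connection M).
Variable theta : smoothFun M.
Implicit Types (X Y : vfield M) (F G : seq (vfield M) -> smoothFun M).
Implicit Types (s t : seq (vfield M)).

(* The value 0 on the empty list restricts shuffle powers to nonempty factors. *)
Definition form_list s : smoothFun M :=
  if nilp s then 0 else covdiff_list D theta (size s) s.

(** The difference is written with [(-1) *] so that [shuffleZl] and [shuffleZr] apply. *)
Definition covderiv Y F s : smoothFun M :=
  Y (F s) + (-1) * subst_deriv (D Y) F s.

Lemma covderiv_shuffle Y F G s : covderiv Y (shuffle F G) s =
  shuffle (covderiv Y F) G s + shuffle F (covderiv Y G) s.
Proof.
rewrite /covderiv subst_deriv_shuffle shuffleDl shuffleDr shuffleZl shuffleZr.
rewrite (@shuffle_deriv _ _ (fun a => Y a : smoothFun M)); last exact: vfieldM.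
  by rewrite mulrDr addrACA.
exact: vfieldD.
Qed.

Lemma form_list_cons Y s :
  form_list (Y :: s) = covderiv Y form_list s + Y theta * empty_one s.
Proof.
rewrite /form_list /covderiv /= mulN1r; case: s => [|Z s] /=.
  by rewrite vfield0 !subr0 add0r mulr1.
rewrite mulr0 addr0; congr (_ - (_ + _)).
by apply: eq_subst_deriv => u /= ->.
Qed.

Lemma covderiv_empty_one Y s : covderiv Y empty_one s = 0.
Proof.
rewrite /covderiv; case: s => [|Z s] /=; first by rewrite mulr0 addr0 vfield1.
by rewrite vfield0 subst_deriv0 addr0 mulr0 addr0.
Qed.

(** By the Leibniz rule each of the [j] factors in turn either is differentiated or absorbs [Y]
    alone. In the second case it becomes [Y theta] times the unit, and the power drops by one. *)
Lemma shuffle_pow_form_cons j Y s :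
  shuffle_pow form_list j (Y :: s) = covderiv Y (shuffle_pow form_list j) s +
    j%:R * Y theta * shuffle_pow form_list j.-1 s.
Proof.
elim: j s => [|j IH] s; first by rewrite covderiv_empty_one !mul0r addr0.
rewrite [LHS]/= [shuffle_pow _ j.+1]/shuffle_pow iterS covderiv_shuffle.
rewrite (eq_shuffle (fun u _ => form_list_cons Y u) (fun _ _ => erefl _)).
rewrite (eq_shuffle (fun _ _ => erefl _) (fun u _ => IH u)).
rewrite shuffleDl shuffleDr !shuffleZl !shuffleZr shuffle1l !addrA.
rewrite -/(shuffle_pow form_list j).
rewrite [X in X + _]addrAC -!addrA; congr (_ + (_ + _)).
case: j {IH} => [|j]; first by rewrite !mul0r addr0 mul1r.
by rewrite -[shuffle _ _ _]/(shuffle_pow form_list j.+1 s) -[j.+2%:R]natr1; ring.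
Qed.

(** Here [c j] stands for Z^(j)(theta) / j!, and the first hypothesis is the chain rule. Shuffle
    powers vanish on lists shorter than the exponent, so every [B] beyond [n] gives the same sum,
    and the induction lowers both together. *)
Lemma covariant_faa_di_bruno (c : nat -> smoothFun M) n s B :
  (forall j Y, Y (c j) = j.+1%:R * c j.+1 * Y theta) ->
  size s = n -> (n < B)%N ->
  covdiff_list D (c 0%N) n s = \sum_(j < B) c j * shuffle_pow form_list j s.
Proof.
move=> dc; elim: n s B => [|n IH] s [|B]//.
  case: s => //= _ _; rewrite big_ord_recl mulr1 big1 ?addr0// => i _.
  by rewrite shuffle_pow_eq0 ?mulr0.
case: s => //= Y s [sn] nB; rewrite (IH s B sn nB) (@eq_subst_deriv _ _ _ _
  (fun u => \sum_(j < B) c j * shuffle_pow form_list j u)); last first.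
  by move=> u us; rewrite (IH _ B)// us.
rewrite subst_deriv_sum; under [X in _ - X]eq_bigr do rewrite subst_derivZ.
rewrite (vfield_sum Y); under [X in X - _]eq_bigr do rewrite vfieldM dc.
under [RHS]eq_bigr do rewrite shuffle_pow_form_cons mulrDr.
rewrite [RHS]big_split /=.
(* The term of index [B] vanishes because [s] has length [n < B]. *)
have -> : \sum_(j < B.+1) c j * covderiv Y (shuffle_pow form_list j) s =
    \sum_(j < B) c j * covderiv Y (shuffle_pow form_list j) s.
  rewrite big_ord_recr /= [X in _ + X](_ : _ = 0) ?addr0//.
  rewrite /covderiv shuffle_pow_eq0 ?sn// vfield0 (@eq_subst_deriv _ _ _ _ (fun=> 0)).
    by rewrite subst_deriv0 mulr0 addr0 mulr0.
  by move=> u us; rewrite shuffle_pow_eq0// us sn.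
(* Dropping the zero term of index 0 shifts the second sum, so that [c j.+1] meets the derivative of
   [c j]. *)
rewrite big_ord_recl /= !mul0r mulr0 add0r.
rewrite -sumrB -big_split /=; apply: eq_bigr => j _.
by rewrite /covderiv /bump /= add1n; ring.
Qed.

Hypotheses (torsionD : torsion_free D) (flatD : flat D).

Lemma form_list_swap : swap_invariant form_list.
Proof.
by move=> u X Y v; rewrite /form_list !size_cat /= covdiff_list_swap//; case: u.
Qed.

Lemma form_listE k (X : 'I_k.+1 -> vfield M) :
  covdiff_form D (differential theta) k X = form_list (listing X).
Proof.
rewrite -[LHS]/(covdiff_fun D theta k.+1 X) covdiff_listE /form_list.
by rewrite size_listing listingS.
Qed.

End covariant_faa_di_bruno.

(** * Multinomials and symmetrised tensor products *)

(** It makes the integer division in [multinomial] exact. *)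
Lemma prod_fact_dvdn j (l : 'I_j -> nat) :
  (\prod_(i < j) (l i)`! %| (\sum_(i < j) l i)`!)%N.
Proof.
apply: (big_rec2 (fun p q => p %| q`!)%N) => // i q p _ pq.
have := bin_fact (leq_addr p (l i)); rewrite addKn => <-.
by rewrite dvdn_mull// dvdn_mul.
Qed.

Lemma multinomialE {K : numFieldType} n j (l : 'I_j -> nat) (a : K) :
  (\sum_(i < j) l i = n)%N ->
  (n`!%:R)^-1 * (a *+ multinomial n l) = a * \prod_(i < j) ((l i)`!%:R)^-1.
Proof.
move=> <-; have /dvdnP[q qE] := prod_fact_dvdn l.
have p0 : (0 < \prod_(i < j) (l i)`!)%N by apply: prodn_gt0 => i; exact: fact_gt0.
have q0 : (q%:R : K) != 0.
  by rewrite pnatr_eq0; apply: contra_eq_neq qE => ->; rewrite mul0n -lt0n fact_gt0.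
rewrite /multinomial qE mulnK// prodfV -natr_prod natrM invfM -(mulr_natr a).
by rewrite mulrC -mulrA mulVKf.
Qed.

(** [tagnat.Rank i l] is [l] plus the total length of the blocks before [i], so the arguments of the
    i-th tensor factor form a consecutive slice. *)
Lemma listing_Rank {A : Type} (x0 : A) n j (m : 'I_j -> nat)
    (e : (\sum_(i < j) m i = n)%N) (Y : 'I_n -> A) (i : 'I_j) :
  listing (fun l : 'I_(m i) => Y (cast_ord e (tagnat.Rank i l))) =
  take (m i) (drop (\sum_(h < j | (h < i)%N) m h) (listing Y)).
Proof.
have le_n : (\sum_(h < j | (h < i)%N) m h + m i <= n)%N.
  rewrite -e [leqRHS](bigD1 i)//= addnC leq_add2l big_mkcond [leqRHS]big_mkcond.
  by apply: leq_sum => h _; case: ltnP => // hi; rewrite ifT// neq_ltn hi.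
apply: (@eq_from_nth _ x0) => [|l].
  rewrite size_listing size_takel// size_drop size_listing leq_subRL//.
  exact: leq_trans (leq_addr _ _) le_n.
rewrite size_listing => lm; rewrite nth_take// nth_drop.
rewrite -[l in LHS]/(val (Ordinal lm)) nth_listing.
have -> : (\sum_(h < j | (h < i)%N) m h + l)%N = val (cast_ord e (tagnat.Rank i (Ordinal lm))).
  exact: (esym (@tagnat.RankEsum j m i (Ordinal lm))).
by rewrite nth_listing.
Qed.

Section evaluation.
Context {R : realType} {d : nat} {M : smoothManifold R d}.
Variable xi : M.

(** As a ring morphism it carries shuffle powers of smooth functions to real ones, where inverse
    factorials are available. *)
Definition eval_at (g : smoothFun M) : R := g xi.

Let eval_at_is_zmod_morphism : zmod_morphism eval_at.
Proof. by []. Qed.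

Let eval_at_is_monoid_morphism : monoid_morphism eval_at.
Proof. by []. Qed.

HB.instance Definition _ :=
  GRing.isZmodMorphism.Build _ _ eval_at eval_at_is_zmod_morphism.
HB.instance Definition _ :=
  GRing.isMonoidMorphism.Build _ _ eval_at eval_at_is_monoid_morphism.

End evaluation.

Section symmetrised_products.
Context {R : realType} {d : nat} {M : smoothManifold R d} (D : connection M).
Variables (theta : smoothFun M) (torsionD : torsion_free D) (flatD : flat D).

Lemma symmetrised_form_products n j (X : 'I_n -> vfield M) xi :
  (n`!%:R)^-1 * symmetrise (fun Y : 'I_n -> vfield M =>
    \sum_(k : offsets n j)
      cast_covariant (offsets_order k)
        (tensor_prod (fun i : 'I_j => covdiff_form D (differential theta) (val k i))) Y
      *+ multinomial n (fun i : 'I_j => (val k i).+1)) X xi =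
  shuffle_pow (form_list D theta) j (listing X) xi.
Proof.
pose w u := eval_at xi (form_list D theta u).
(* All rearrangements of [u] give [w] the same value, so this weight makes the arrangement sum of
   [V] equal to [w]. *)
pose V u := ((size u)`!%:R)^-1 * w u.
have wS : swap_invariant w.
  by move=> u a c v; rewrite /w form_list_swap.
have VS : swap_invariant V.
  by move=> u a c v; rewrite /V wS !size_cat.
have arrV u : arrangements_sum V u = w u.
  rewrite arrangements_sum_swap// -mulr_natl /V mulrA divff ?mul1r//.
rewrite -[RHS]/(eval_at xi _) rmorph_shuffle_pow.
have -> : shuffle_pow (fun u => eval_at xi (form_list D theta u)) j (listing X) =
    shuffle_pow (arrangements_sum V) j (listing X).
  by congr (shuffle_pow _ j _); apply/funext => u; rewrite arrV.
rewrite -arrangements_sum_conc_pow arrangements_sum_listing.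
rewrite -[X in _ * X]/(eval_at xi _) raddf_sum mulr_sumr; apply: eq_bigr => s _.
rewrite raddf_sum mulr_sumr (@conc_pow_blocks _ _ n.+1) ?size_listing//; last first.
  by rewrite /V /w /form_list mulr0.
rewrite (eq_bigl (fun k : {ffun 'I_j -> 'I_n.+1} => \sum_(i < j) k i + j == n)%N); last first.
  by move=> k; under eq_bigr do rewrite -addn1; rewrite big_split /= sum1_card card_ord.
rewrite [RHS](reindex_omap (val : offsets n j -> _) insub) => [|k kP]; last by rewrite insubT.
apply: eq_big => [k|k _]; first by rewrite valK eqxx andbT (valP k).
rewrite raddfMn multinomialE ?offsets_order//.
rewrite -[X in X * _]/(eval_at xi (\prod_(i < j)
  covdiff_form D (differential theta) (val k i) (fun l =>
    X (s (cast_ord (offsets_order k) (tagnat.Rank i l)))))).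
rewrite rmorph_prod -big_split /=; apply: eq_bigr => i _.
rewrite form_listE; set u := listing _.
have uE : u = take (val k i).+1 (drop (\sum_(h < j | (h < i)%N) (val k h).+1)
    (listing (fun l => X (s l)))).
  exact: (listing_Rank 0 (m := fun i => (val k i).+1) (offsets_order k) (fun l => X (s l))).
by rewrite -uE /V size_listing mulrC.
Qed.

End symmetrised_products.

Theorem theorem4p13 (R : realType) (N : ptopologicalType)
    (nu : {measure set (borel N) -> \bar R}) (f : N -> R)
    (d : nat) (Gamma : smoothManifold R d) (D : connection Gamma)
    (theta : smoothFun Gamma) :
  nu setT != 0%E ->
  bounded_fun f -> continuous f ->
  torsion_free D -> flat D ->
  (forall xi : Gamma, exists X : 'I_1 -> vfield Gamma,
     differential theta X xi != 0) ->
  (forall xi : Gamma, (\int[nu]_x (expR (theta xi * f x))%:E < +oo)%E) ->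
  exists z : smoothFun Gamma,
    (forall xi : Gamma, z xi = ln (\int[nu]_x expR (theta xi * f x))) /\
    (forall n : nat, (1 <= n)%N ->
     forall (X : 'I_n -> vfield Gamma) (xi : Gamma),
     covdiff_fun D z n X xi =
     \sum_(1 <= j < n.+1)
       (j`!%:R)^-1 * gibbs_mean nu f (theta xi) (fseq nu f j ^~ (theta xi)) *
       ((n`!%:R)^-1 *
        symmetrise (fun Y : 'I_n -> vfield Gamma =>
          \sum_(k : offsets n j)
            cast_covariant (offsets_order k)
              (tensor_prod (fun i : 'I_j =>
                 covdiff_form D (differential theta) (val k i))) Y
            *+ multinomial n (fun i : 'I_j => (val k i).+1)) X xi)).
Proof.
move=> nu_neq0 bf cf torsionD flatD _ expfin.
(* Finiteness of [nu] will be read off at one point [xi0]; over an empty manifold any [z] will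
   do. *)
have [[xi0 _]|Gamma0] := pselect (exists xi : Gamma, True); last first.
  by exists 0; split=> [xi|n _ X xi]; case: Gamma0; exists xi.
have mf := continuous_borel_measurable cf.
have [b fb] : exists b : R, forall x, `|f x| <= b.
  (* [bounded_fun] provides bounds only strictly above [M]. *)
  have [M [_ Mb]] := bf; exists (`|M| + 1) => x.
  by apply: (Mb (`|M| + 1)) => //; rewrite (le_lt_trans (ler_norm M))// ltrDl.
have nu_fin : (nu setT < +oo)%E.
  (* The density at [xi0] is at least [c > 0], so its finite integral forces [nu] to be finite. *)
  pose c := expR (- (`|theta xi0| * b)).
  have : (c%:E * nu setT < +oo)%E.
    rewrite -integral_cst//; apply: le_lt_trans (expfin xi0).
    apply: ge0_le_integral => //.
    - by move=> x _; rewrite lee_fin expR_ge0.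
    - suff : measurable_fun setT (fun x : borel N => expR (theta xi0 * f x)).
        by move/measurable_EFinP.
      by apply: measurableT_comp => //; exact: measurable_funM.
    - move=> x _; rewrite lee_fin ler_expR.
      have := ler_norm (- (theta xi0 * f x)); rewrite normrN normrM.
      have := ler_wpM2l (normr_ge0 (theta xi0)) (fb x); lra.
  have := measure_ge0 nu setT; case: (nu setT) => [r _ _|_|//]; first exact: ltry.
  by rewrite gt0_muley// lte_fin expR_gt0.
have sZ := smoothR_cumulant nu_neq0 nu_fin mf fb.
have dZ j : derive1 (cumulant nu f j) = cumulant nu f j.+1.
  by apply: derive1_eq; exact: (is_derive_cumulant nu_neq0 nu_fin mf fb).
(* Taylor coefficients of the log-partition function at theta; [c 0] is the required [z]. *)
pose c j : smoothFun Gamma := (j`!%:R)^-1 *: smooth_comp theta (sZ j).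
have cY j (Y : vfield Gamma) : Y (c j) = j.+1%:R * c j.+1 * Y theta.
  have dcomp : smooth_comp theta (smoothR_derive1 (sZ j)) = smooth_comp theta (sZ j.+1).
    by apply: smoothFun_eqP => x; rewrite -[LHS]/(derive1 _ _) dZ.
  rewrite /c vfieldZ vfield_comp dcomp; apply: smoothFun_eqP => x.
  rewrite !smoothFunE -[(j.+1%:R : smoothFun Gamma) x]/(eval_at x j.+1%:R) rmorph_nat.
  by rewrite factS natrM invfM !mulrA divff ?pnatr_eq0// mul1r.
exists (c 0%N); split=> [xi|[//|n] _ X xi].
  by rewrite /c smoothFunE fact0 invr1 mul1r.
rewrite covdiff_listE (@covariant_faa_di_bruno _ _ _ D theta c _ _ _ cY (size_listing X) (ltnSn _)).
(* The term of index 0 vanishes because the list of arguments is nonempty, so the sum starts at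
   1. *)
rewrite big_ord_recl [X in X + _](_ : _ = 0) ?add0r; last by rewrite listingS /= mulr0.
rewrite -[LHS]/(eval_at xi _) rmorph_sum big_add1 big_mkord.
apply: eq_bigr => j _; rewrite (symmetrised_form_products theta torsionD flatD) rmorphM.
by congr (_ * _).
Qed.
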